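(* Let $p>0$ be real, let $\sigma(t)=\frac{p+t}{p-t}$, and for each integer $n\ge 1$ let $\lambda_n$ be the root of $\tan(\pi x)=-x/p$ lying in $(n-\tfrac12,n)$. Let $f(z)$ be analytic for $\operatorname{Re}(z)\ge 0$, and write $z=x+iy$. Suppose that $$\int_0^\infty |f(x+iy)|\,dx<\infty \quad (y\in\mathbb{R}),$$ and that this integral is bounded as $|y|\to\infty$. Assume that $$\lim_{y\to\infty}|f(x\pm iy)|e^{-2\pi y}=0$$ uniformly in $x$ on every finite interval (in $x\ge 0$), that $$\lim_{r\to\infty}\int_{-\infty}^{\infty}e^{-2\pi|y|}|f(r+iy)|\,dy=0,$$ and that $\sum_{n=1}^\infty f(\lambda_n)$ converges. Then $$\sum_{n=1}^{\infty}f(\lambda_n)=-\frac12 f(0)+\int_0^{\infty}\frac{p\left(p+\frac1\pi\right)+x^2}{p^2+x^2}f(x)\,dx+i\int_0^{\infty}\{f(it)-f(-it)\}\frac{\sigma(-t)+\sigma'(-t)/(2\pi)}{e^{2\pi t}-\sigma(-t)}\,dt.$$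
   Context: Here $\sigma(-t)=\frac{p-t}{p+t}$, and $\sigma'(-t)$ is the derivative of $\sigma$ evaluated at $-t$, i.e. $\sigma'(-t)=\frac{2p}{(p+t)^2}$. There is exactly one root $\lambda_n$ of $\tan(\pi x)=-x/p$ in each interval $(n-\tfrac12,n)$, $n\ge1$. Integrals over $[0,\infty)$ in the conclusion are understood as improper integrals. *)

(* Defs.v *)
From Stdlib Require Import Reals.
From Coquelicot Require Import Coquelicot.
Open Scope R_scope.

Definition analytic_at (f : C -> C) (z : C) : Prop :=
  @locally C_UniformSpace z
    (fun w : C => @ex_derive C_AbsRing C_NormedModule f w).

Definition koshliakov_sigma (p t : R) : R := (p + t) / (p - t).

(* Improper integrals: limits of proper Riemann integrals over [0, b] as
   b -> +oo, respectively over [a, b] as a -> -oo and b -> +oo independently. *)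
Definition is_RInt_0_infty (g : R -> R) (l : R) : Prop :=
  is_RInt_gen g (at_point 0) (Rbar_locally p_infty) l.

Definition is_CInt_0_infty (g : R -> C) (l : C) : Prop :=
  @is_RInt_gen C_R_NormedModule g (at_point 0) (Rbar_locally p_infty) l.

Definition is_RInt_line (g : R -> R) (l : R) : Prop :=
  is_RInt_gen g (Rbar_locally m_infty) (Rbar_locally p_infty) l.

(* Main.v *)
Require Import Defs.
From Stdlib Require Import Reals Lra Lia Psatz ClassicalEpsilon.
From Coquelicot Require Import Coquelicot.
Open Scope R_scope.

(** The formula is a Poisson summation along a curved phase.  Let
    w(z) = e^{2 pi i z} (p + i z) / (p - i z).  For real x this is e^{i theta(x)}
    with theta(x) = 2 pi x + 2 atan(x / p), which is strictly increasing, vanishes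
    at 0 and equals 2 pi n exactly at lambda_n ([theta_root]).  The points 0 and
    lambda_n are thus the nonnegative solutions of w = 1, and the Poisson kernel
    P_r(theta) = (1 - r^2) / (1 - 2 r cos theta + r^2) picks them out: as r -> 1,
    the integral of f theta' P_r(theta) over [0, N] tends to
    2 pi (f(0) / 2 + sum_{n <= N} f(lambda_n)) ([phase_poisson_limit]).  The end
    point 0 receives only half of the mass of the kernel; this is where the term
    - f(0) / 2 comes from.

    On the other hand P_r(theta) = 1 + r w / (1 - r w) + its conjugate.  The summand
    1 contributes the integral of theta' f, and theta' / (2 pi) is the weight of the
    first integral.  Up to a factor i, the second summand times theta' is the
    restriction to the real axis of g_r = r w' / (1 - r w).  In the closed first
    quadrant |w| <= e^{-2 pi y}, so for r < 1 the function g_r has no pole there, and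
    Cauchy's theorem on the rectangle [0, N] x [0, T] ([cauchy_rectangle]) moves the
    integral of f g_r to the imaginary axis.  On that axis w(i t) = e^{-2 pi t} sigma(-t)
    is real and g_r becomes a damped form of the kernel of the second integral.  The
    conjugate summand is the same computation for the function conj f(conj z), and
    yields the part with f(-i t).  The two other sides of the rectangle contribute an
    error bounded, uniformly in r, by e^{-2 pi y} |f| integrated along them: the
    denominator 1 - r w is small neither at height T >= 1 nor above an integer N >= p,
    where Re w <= 0.  This is [contour_estimate].  Because the damping r keeps all
    poles off the contour, neither residues nor indentations are needed.

    It remains to take limits in the order r -> 1, T -> oo, N -> oo.  On the imaginary
    axis the damped kernel develops a singularity 1 / t at t = 0, which is compensated
    by the zero of f(i t) - f(-i t) ([axis_kernel_limit]).  The first integral converges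
    absolutely, the series converges by assumption, the top side vanishes as T -> oo,
    and the right side is bounded by an integral that vanishes as N -> oo.  Hence the
    integral over [0, T] on the imaginary axis is forced to converge to the value that
    makes the formula true. *)

Local Notation ccont := (@continuous R_UniformSpace C_UniformSpace).

(** * Complex-valued integrals over real intervals *)

(** The target is C as a real normed module, so that the general theory of Riemann
    integrals applies; complex scalars are handled by passing to components. *)
Definition CInt (g : R -> C) (a b : R) : C := @RInt C_R_CompleteNormedModule g a b.

Definition ex_CInt (g : R -> C) (a b : R) : Prop := @ex_RInt C_R_NormedModule g a b.

Lemma ex_CInt_ccont (g : R -> C) (a b : R) :
  a <= b -> (forall x, a <= x <= b -> ccont g x) -> ex_CInt g a b.
Proof.
  intros Hab H. apply (@ex_RInt_continuous C_R_CompleteNormedModule).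
  rewrite Rmin_left, Rmax_right; auto.
Qed.

Lemma is_CInt (g : R -> C) (a b : R) :
  ex_CInt g a b -> @is_RInt C_R_NormedModule g a b (CInt g a b).
Proof. exact (@RInt_correct C_R_CompleteNormedModule g a b). Qed.

Lemma CInt_unique (g : R -> C) (a b : R) (l : C) :
  @is_RInt C_R_NormedModule g a b l -> CInt g a b = l.
Proof. exact (@is_RInt_unique C_R_CompleteNormedModule g a b l). Qed.

Lemma CInt_ext (f g : R -> C) (a b : R) :
  a <= b -> (forall x, a < x < b -> f x = g x) -> CInt f a b = CInt g a b.
Proof.
  intros Hab H. apply (@RInt_ext C_R_CompleteNormedModule).
  rewrite Rmin_left, Rmax_right; auto.
Qed.

Lemma CInt_plus (f g : R -> C) (a b : R) :
  ex_CInt f a b -> ex_CInt g a b ->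
  CInt (fun x => f x + g x)%C a b = (CInt f a b + CInt g a b)%C.
Proof. exact (@RInt_plus C_R_CompleteNormedModule f g a b). Qed.

Lemma CInt_minus (f g : R -> C) (a b : R) :
  ex_CInt f a b -> ex_CInt g a b ->
  CInt (fun x => f x - g x)%C a b = (CInt f a b - CInt g a b)%C.
Proof. exact (@RInt_minus C_R_CompleteNormedModule f g a b). Qed.

Lemma CInt_Chasles (f : R -> C) (a b c : R) :
  ex_CInt f a b -> ex_CInt f b c -> (CInt f a b + CInt f b c)%C = CInt f a c.
Proof. exact (@RInt_Chasles C_R_CompleteNormedModule f a b c). Qed.

Lemma is_CInt_pair (f : R -> C) (a b : R) (l : C) :
  @is_RInt C_R_NormedModule f a b l <->
  is_RInt (fun t => fst (f t)) a b (fst l) /\ is_RInt (fun t => snd (f t)) a b (snd l).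
Proof.
  split.
  - intros H. split.
    + exact (@is_RInt_fct_extend_fst R_NormedModule R_NormedModule f a b l H).
    + exact (@is_RInt_fct_extend_snd R_NormedModule R_NormedModule f a b l H).
  - intros [H1 H2]. destruct l as [l1 l2].
    exact (@is_RInt_fct_extend_pair R_NormedModule R_NormedModule f a b l1 l2 H1 H2).
Qed.

Lemma is_CInt_scal (f : R -> C) (a b : R) (k l : C) :
  @is_RInt C_R_NormedModule f a b l ->
  @is_RInt C_R_NormedModule (fun x => k * f x)%C a b (k * l)%C.
Proof.
  rewrite !is_CInt_pair. intros [H1 H2]. simpl. split.
  - apply (is_RInt_minus (V := R_NormedModule)); apply (is_RInt_scal (V := R_NormedModule)); assumption.
  - apply (is_RInt_plus (V := R_NormedModule)); apply (is_RInt_scal (V := R_NormedModule)); assumption.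
Qed.

Lemma CInt_scal (f : R -> C) (a b : R) (k : C) :
  ex_CInt f a b -> CInt (fun x => k * f x)%C a b = (k * CInt f a b)%C.
Proof. intros H. apply CInt_unique, is_CInt_scal, is_CInt, H. Qed.

Lemma is_CInt_conj (f : R -> C) (a b : R) (l : C) :
  @is_RInt C_R_NormedModule f a b l ->
  @is_RInt C_R_NormedModule (fun x => Cconj (f x)) a b (Cconj l).
Proof.
  rewrite !is_CInt_pair. intros [H1 H2]. split; [exact H1|].
  apply (is_RInt_opp (V := R_NormedModule)); exact H2.
Qed.

Lemma CInt_conj (f : R -> C) (a b : R) :
  ex_CInt f a b -> CInt (fun x => Cconj (f x)) a b = Cconj (CInt f a b).
Proof. intros H. apply CInt_unique, is_CInt_conj, is_CInt, H. Qed.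

Lemma ex_CInt_conj (f : R -> C) (a b : R) :
  ex_CInt f a b -> ex_CInt (fun x => Cconj (f x)) a b.
Proof. intros [l H]. exists (Cconj l). apply is_CInt_conj, H. Qed.

Lemma ex_CInt_scal (f : R -> C) (a b : R) (k : C) :
  ex_CInt f a b -> ex_CInt (fun x => k * f x)%C a b.
Proof. intros [l H]. exists (k * l)%C. apply is_CInt_scal, H. Qed.

Lemma ex_CInt_plus (f g : R -> C) (a b : R) :
  ex_CInt f a b -> ex_CInt g a b -> ex_CInt (fun x => f x + g x)%C a b.
Proof. exact (@ex_RInt_plus C_R_NormedModule f g a b). Qed.

Lemma ex_CInt_minus (f g : R -> C) (a b : R) :
  ex_CInt f a b -> ex_CInt g a b -> ex_CInt (fun x => f x - g x)%C a b.
Proof. exact (@ex_RInt_minus C_R_NormedModule f g a b). Qed.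

Lemma CInt_norm_le (f : R -> C) (g : R -> R) (a b : R) :
  a <= b -> ex_CInt f a b -> ex_RInt g a b ->
  (forall x, a <= x <= b -> Cmod (f x) <= g x) ->
  Cmod (CInt f a b) <= RInt g a b.
Proof.
  intros Hab Hf Hg H. rewrite Cmod_norm.
  apply (@norm_RInt_le C_R_NormedModule f g a b); auto.
  - intros x Hx. rewrite <- Cmod_norm. auto.
  - apply is_CInt; auto.
  - exact (RInt_correct g a b Hg).
Qed.

Lemma CInt_norm_le_const (f : R -> C) (a b M : R) :
  a <= b -> ex_CInt f a b -> (forall x, a <= x <= b -> Cmod (f x) <= M) ->
  Cmod (CInt f a b) <= (b - a) * M.
Proof.
  intros Hab Hf H.
  replace ((b - a) * M) with (RInt (fun _ => M) a b)
    by (rewrite RInt_const; reflexivity).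
  apply CInt_norm_le; auto. apply ex_RInt_const.
Qed.

Lemma CInt_affine (al be : C) (a b : R) :
  CInt (fun x => al + be * RtoC x)%C a b
  = (al * (RtoC b - RtoC a) + be * (RtoC b * RtoC b - RtoC a * RtoC a) * RtoC (1 / 2))%C.
Proof.
  assert (H : forall u v : R,
    is_RInt (fun x => u + v * x) a b (u * (b - a) + v * (b * b - a * a) / 2)).
  { intros u v.
    replace (u * (b - a) + v * (b * b - a * a) / 2)
      with (minus ((u * b + v * (b * b) / 2)) (u * a + v * (a * a) / 2))
      by (unfold minus, plus, opp; simpl; lra).
    apply (is_RInt_derive (fun x => u * x + v * (x * x) / 2)).
    - intros x _. auto_derive; [exact I|lra].
    - intros x _. apply (ex_derive_continuous (fun x => u + v * x)). auto_derive; exact I. }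
  apply CInt_unique. apply is_CInt_pair. split.
  - eapply is_RInt_ext; [|match goal with |- is_RInt _ _ _ ?l => replace l with
      (fst al * (b - a) + fst be * (b * b - a * a) / 2); [apply H|] end].
    + intros x _. simpl. ring.
    + simpl. lra.
  - eapply is_RInt_ext; [|match goal with |- is_RInt _ _ _ ?l => replace l with
      (snd al * (b - a) + snd be * (b * b - a * a) / 2); [apply H|] end].
    + intros x _. simpl. ring.
    + simpl. lra.
Qed.

(** * Complex differentiability *)

Local Notation cdiff := (@ex_derive C_AbsRing C_NormedModule).

Lemma Cmod_fst (z : C) : Rabs (fst z) <= Cmod z.
Proof. apply Rle_trans with (2 := Rmax_Cmod z), Rmax_l. Qed.

Lemma Cmod_snd (z : C) : Rabs (snd z) <= Cmod z.
Proof. apply Rle_trans with (2 := Rmax_Cmod z), Rmax_r. Qed.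

Lemma pair_C (x y : R) : ((x, y) : C) = (RtoC x + Ci * RtoC y)%C.
Proof. unfold RtoC, Ci, Cplus, Cmult; simpl; f_equal; ring. Qed.

Lemma Cmod_le_sum (z : C) : Cmod z <= Rabs (fst z) + Rabs (snd z).
Proof.
  destruct z as [x y].
  change (Cmod (x, y) <= Rabs x + Rabs y). rewrite pair_C.
  eapply Rle_trans; [apply Cmod_triangle|].
  rewrite Cmod_mult, Cmod_Ci, !Cmod_R. lra.
Qed.

(** The filter-based derivative, unfolded to the first-order estimate in terms of the
    modulus; all later estimates use this form. *)
Lemma is_cderive_eps (h : C -> C) (z l : C) :
  @is_derive C_AbsRing C_NormedModule h z l ->
  forall eps, 0 < eps -> exists del, 0 < del /\ forall w, Cmod (w - z) < del ->
    Cmod (h w - h z - (w - z) * l) <= eps * Cmod (w - z).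
Proof.
  intros [_ H] eps Heps.
  destruct (H z (fun P HP => HP) (mkposreal eps Heps)) as [del Hdel].
  exists del. split; [apply cond_pos|]. intros w Hw. exact (Hdel w Hw).
Qed.

Lemma eps_is_cderive (h : C -> C) (z l : C) :
  (forall eps, 0 < eps -> exists del, 0 < del /\ forall w, Cmod (w - z) < del ->
    Cmod (h w - h z - (w - z) * l) <= eps * Cmod (w - z)) ->
  @is_derive C_AbsRing C_NormedModule h z l.
Proof.
  intros H. split; [apply is_linear_scal_l|].
  intros x Hx eps.
  assert (x = z) as ->.
  { symmetry. exact (@is_filter_lim_locally_unique C_AbsRing (AbsRing_NormedModule C_AbsRing) _ _ Hx). }
  destruct (H eps (cond_pos eps)) as [del [Hd Hdel]].
  exists (mkposreal del Hd). intros w Hw. exact (Hdel w Hw).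
Qed.

Lemma cdiff_cont_eps (h : C -> C) (z : C) :
  cdiff h z -> forall eps, 0 < eps -> exists del, 0 < del /\
    forall w, Cmod (w - z) < del -> Cmod (h w - h z) < eps.
Proof.
  intros [l Hl] eps Heps.
  destruct (is_cderive_eps h z l Hl 1 Rlt_0_1) as [d1 [Hd1 H1]].
  pose proof (Cmod_ge_0 l) as Hl0.
  assert (Hq : 0 < eps / (2 + Cmod l)) by (apply Rdiv_lt_0_compat; lra).
  exists (Rmin d1 (eps / (2 + Cmod l))). split; [apply Rmin_pos; lra|].
  intros w Hw.
  assert (Hw1 : Cmod (w - z) < d1) by (eapply Rlt_le_trans; [apply Hw|apply Rmin_l]).
  assert (Hw2 : Cmod (w - z) < eps / (2 + Cmod l)) by (eapply Rlt_le_trans; [apply Hw|apply Rmin_r]).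
  replace (h w - h z)%C with ((h w - h z - (w - z) * l) + (w - z) * l)%C by ring.
  eapply Rle_lt_trans; [apply Cmod_triangle|].
  specialize (H1 w Hw1). rewrite Cmod_mult.
  pose proof (Cmod_ge_0 (w - z)).
  assert (Cmod (w - z) * (2 + Cmod l) < eps).
  { apply Rmult_lt_compat_r with (r := 2 + Cmod l) in Hw2; [|lra].
    unfold Rdiv in Hw2. rewrite Rmult_assoc, Rinv_l in Hw2; lra. }
  nra.
Qed.

Lemma ccont_eps (g : R -> C) (x : R) :
  (forall eps, 0 < eps -> exists del, 0 < del /\
     forall t, Rabs (t - x) < del -> Cmod (g t - g x) < eps) -> ccont g x.
Proof.
  intros H. apply filterlim_locally. intros eps.
  destruct (H eps (cond_pos eps)) as [del [Hd Hdel]].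
  exists (mkposreal del Hd). intros t Ht. specialize (Hdel t Ht).
  split.
  - eapply Rle_lt_trans; [|apply Hdel]. exact (Cmod_fst (g t - g x)%C).
  - eapply Rle_lt_trans; [|apply Hdel]. exact (Cmod_snd (g t - g x)%C).
Qed.

Lemma cdiff_line_x (h : C -> C) (x y : R) :
  cdiff h (x, y) -> ccont (fun t => h (t, y)) x.
Proof.
  intros H. apply ccont_eps. intros eps He.
  destruct (cdiff_cont_eps _ _ H eps He) as [del [Hd Hdel]].
  exists del. split; auto. intros t Ht. apply Hdel.
  change (Cmod ((t, y) - (x, y)) < del).
  replace ((t, y) - (x, y))%C with (RtoC (t - x)) by (unfold RtoC, Cminus, Cplus, Copp; simpl; f_equal; ring).
  rewrite Cmod_R. exact Ht.
Qed.

Lemma cdiff_line_y (h : C -> C) (x y : R) :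
  cdiff h (x, y) -> ccont (fun t => h (x, t)) y.
Proof.
  intros H. apply ccont_eps. intros eps He.
  destruct (cdiff_cont_eps _ _ H eps He) as [del [Hd Hdel]].
  exists del. split; auto. intros t Ht. apply Hdel.
  change (Cmod ((x, t) - (x, y)) < del).
  replace ((x, t) - (x, y))%C with (Ci * RtoC (t - y))%C
    by (unfold RtoC, Ci, Cminus, Cplus, Cmult, Copp; simpl; f_equal; ring).
  rewrite Cmod_mult, Cmod_Ci, Cmod_R, Rmult_1_l. exact Ht.
Qed.

(** * Cauchy's theorem for a rectangle *)

(** The contour integral along the boundary of [a, b] x [c, d], counterclockwise. *)
Definition rect_integral (h : C -> C) (a b c d : R) : C :=
  (CInt (fun x => h (x, c)) a b + Ci * CInt (fun y => h (b, y)) c d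
   - CInt (fun x => h (x, d)) a b - Ci * CInt (fun y => h (a, y)) c d)%C.

Lemma half_pow_small (L del : R) : 0 < del -> exists n, L * (1 / 2) ^ n < del.
Proof.
  intros Hd.
  destruct (pow_lt_1_zero (1 / 2) ltac:(rewrite Rabs_pos_eq; lra) (del / (Rabs L + 1)))
    as [n Hn]; [apply Rdiv_lt_0_compat; [lra|pose proof (Rabs_pos L); lra]|].
  exists n. specialize (Hn n (le_n n)).
  assert (Hp : 0 < (1 / 2) ^ n) by (apply pow_lt; lra).
  rewrite Rabs_pos_eq in Hn by lra.
  pose proof (Rabs_pos L). pose proof (Rle_abs L).
  apply Rmult_lt_compat_r with (r := Rabs L + 1) in Hn; [|lra].
  unfold Rdiv in Hn. rewrite (Rmult_assoc del), Rinv_l in Hn by lra. nra.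
Qed.

(** The left ends increase and the right ends u n + L / 2^n decrease, so the supremum
    of the left ends lies in all the intervals. *)
Lemma nested_point (u : nat -> R) (L : R) :
  0 <= L ->
  (forall n, u (S n) = u n \/ u (S n) = u n + L * (1 / 2) ^ S n) ->
  exists x, forall n, u n <= x <= u n + L * (1 / 2) ^ n.
Proof.
  intros HL Hu.
  assert (Hp : forall n, 0 <= L * (1 / 2) ^ n)
    by (intros n; apply Rmult_le_pos; [lra|apply pow_le; lra]).
  assert (Hi : forall n, u n <= u (S n)).
  { intros n. specialize (Hp (S n)). destruct (Hu n) as [-> | ->]; lra. }
  assert (Hd : forall n, u (S n) + L * (1 / 2) ^ S n <= u n + L * (1 / 2) ^ n).
  { intros n. pose proof (Hp (S n)) as H1. simpl in *.
    destruct (Hu n) as [-> | ->]; simpl; lra. }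
  assert (Hi' : forall n m, u n <= u (n + m)%nat).
  { intros n m; induction m; [rewrite Nat.add_0_r; lra|].
    rewrite Nat.add_succ_r. specialize (Hi (n + m)%nat). lra. }
  assert (Hd' : forall n m, u (n + m)%nat + L * (1 / 2) ^ (n + m) <= u n + L * (1 / 2) ^ n).
  { intros n m; induction m; [rewrite Nat.add_0_r; lra|].
    rewrite Nat.add_succ_r. specialize (Hd (n + m)%nat). lra. }
  assert (Hb : forall n m, u m <= u n + L * (1 / 2) ^ n).
  { intros n m. specialize (Hi' m n). specialize (Hd' n m). specialize (Hp (n + m)%nat).
    rewrite Nat.add_comm in Hi'. lra. }
  destruct (completeness (fun x => exists n, x = u n)) as [x [Hx1 Hx2]].
  - exists (u 0%nat + L * (1 / 2) ^ 0). intros y [n ->]. apply Hb.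
  - exists (u 0%nat). exists 0%nat. reflexivity.
  - exists x. intros n. split.
    + apply Hx1. exists n; reflexivity.
    + apply Hx2. intros y [m ->]. apply Hb.
Qed.

(** A compactness principle in the form that Goursat's argument needs: if the property
    failed for the whole rectangle, it would fail for one of the four quarters, again
    and again, and the nested failing rectangles would shrink to a point (u, v),
    contradicting the local hypothesis there. *)
Lemma rectangle_bisection (P : R -> R -> R -> R -> Prop) (a b c d : R) :
  a <= b -> c <= d ->
  (forall x x' y y', a <= x -> x <= x' -> x' <= b -> c <= y -> y <= y' -> y' <= d ->
     let m := (x + x') / 2 in let n := (y + y') / 2 in
     P x m y n -> P m x' y n -> P x m n y' -> P m x' n y' -> P x x' y y') ->
  (forall u v, a <= u <= b -> c <= v <= d -> exists del, 0 < del /\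
     forall x x' y y', a <= x -> x <= u <= x' -> x' <= b -> c <= y -> y <= v <= y' -> y' <= d ->
       x' - x < del -> y' - y < del -> P x x' y y') ->
  P a b c d.
Proof.
  intros Hab Hcd Hq Hl. apply NNPP. intros HN.
  set (hw := fun n : nat => (1 / 2) ^ n).
  set (bad := fun (n : nat) (q : R * R) =>
    ~ P (fst q) (fst q + (b - a) * hw n) (snd q) (snd q + (d - c) * hw n)).
  set (inside := fun (n : nat) (q : R * R) =>
    a <= fst q /\ fst q + (b - a) * hw n <= b /\ c <= snd q /\ snd q + (d - c) * hw n <= d).
  set (next := fun (n : nat) (q q' : R * R) =>
    (fst q' = fst q \/ fst q' = fst q + (b - a) * hw (S n)) /\
    (snd q' = snd q \/ snd q' = snd q + (d - c) * hw (S n))).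
  assert (Hhp : forall n, 0 < hw n) by (intros n; apply pow_lt; lra).
  assert (HhS : forall n, hw (S n) = hw n / 2) by (intros n; unfold hw; simpl; lra).
  assert (Hstep : forall n q, bad n q -> inside n q ->
    exists q', bad (S n) q' /\ inside (S n) q' /\ next n q q').
  { intros n [x y] Hb Hi. unfold bad, inside, next in *. simpl in *.
    set (X := (b - a) * hw (S n)). set (Y := (d - c) * hw (S n)).
    assert (HX : (b - a) * hw n = 2 * X) by (unfold X; rewrite HhS; lra).
    assert (HY : (d - c) * hw n = 2 * Y) by (unfold Y; rewrite HhS; lra).
    rewrite HX, HY in *.
    assert (0 <= X) by (unfold X; apply Rmult_le_pos; [lra|apply Rlt_le, Hhp]).
    assert (0 <= Y) by (unfold Y; apply Rmult_le_pos; [lra|apply Rlt_le, Hhp]).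
    apply NNPP. intros Hno. apply Hb. apply Hq; try lra.
    all: replace ((x + (x + 2 * X)) / 2) with (x + X) by lra;
         replace ((y + (y + 2 * Y)) / 2) with (y + Y) by lra.
    all: apply NNPP; intros Hb'; apply Hno.
    - exists (x, y); simpl; fold X Y; repeat split; auto; lra.
    - exists (x + X, y); simpl; fold X Y;
        replace (x + X + X) with (x + 2 * X) by lra; repeat split; auto; lra.
    - exists (x, y + Y); simpl; fold X Y;
        replace (y + Y + Y) with (y + 2 * Y) by lra; repeat split; auto; lra.
    - exists (x + X, y + Y); simpl; fold X Y;
        replace (y + Y + Y) with (y + 2 * Y) by lra;
        replace (x + X + X) with (x + 2 * X) by lra; repeat split; auto; lra. }
  set (next_of := fun (n : nat) (q : R * R) =>
    epsilon (inhabits q) (fun q' => bad (S n) q' /\ inside (S n) q' /\ next n q q')).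
  set (s := fix s n := match n with O => (a, c) | S k => next_of k (s k) end).
  assert (Hs : forall n, bad n (s n) /\ inside n (s n)).
  { induction n as [|n [IH1 IH2]].
    - unfold bad, inside, hw. simpl. rewrite !Rmult_1_r.
      replace (a + (b - a)) with b by lra. replace (c + (d - c)) with d by lra.
      repeat split; auto; lra.
    - destruct (epsilon_spec (inhabits (s n)) _ (Hstep n (s n) IH1 IH2)) as [H1 [H2 _]].
      split; assumption. }
  assert (Hn : forall n, next n (s n) (s (S n))).
  { intros n. destruct (Hs n) as [IH1 IH2].
    destruct (epsilon_spec (inhabits (s n)) _ (Hstep n (s n) IH1 IH2)) as [_ [_ H3]].
    exact H3. }
  destruct (nested_point (fun n => fst (s n)) (b - a)) as [u Hu];
    [lra|intros n; apply (proj1 (Hn n))|].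
  destruct (nested_point (fun n => snd (s n)) (d - c)) as [v Hv];
    [lra|intros n; apply (proj2 (Hn n))|].
  destruct (Hl u v) as [del [Hd Hdel]].
  - specialize (Hu 0%nat). simpl in Hu. lra.
  - specialize (Hv 0%nat). simpl in Hv. lra.
  - destruct (half_pow_small (Rmax (b - a) (d - c)) del Hd) as [n Hsm].
    destruct (Hs n) as [Hb Hi]. apply Hb.
    unfold inside in Hi. pose proof (Hhp n) as Hp. fold (hw n) in Hsm.
    pose proof (Rmax_l (b - a) (d - c)). pose proof (Rmax_r (b - a) (d - c)).
    specialize (Hu n). specialize (Hv n). fold (hw n) in Hu, Hv.
    apply Hdel; try lra; nra.
Qed.

Lemma rect_integral_split (h : C -> C) (a b c d m n : R) :
  a <= m <= b -> c <= n <= d ->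
  (forall x y, a <= x <= b -> c <= y <= d -> cdiff h (x, y)) ->
  rect_integral h a b c d =
  (rect_integral h a m c n + rect_integral h m b c n
   + rect_integral h a m n d + rect_integral h m b n d)%C.
Proof.
  intros Hm Hn H. unfold rect_integral.
  assert (Hx : forall y, c <= y <= d ->
    CInt (fun x => h (x, y)) a b
    = (CInt (fun x => h (x, y)) a m + CInt (fun x => h (x, y)) m b)%C).
  { intros y Hy. symmetry. apply CInt_Chasles; apply ex_CInt_ccont; try lra;
      intros; apply cdiff_line_x, H; lra. }
  assert (Hy : forall x, a <= x <= b ->
    CInt (fun y => h (x, y)) c d
    = (CInt (fun y => h (x, y)) c n + CInt (fun y => h (x, y)) n d)%C).
  { intros x Hx'. symmetry. apply CInt_Chasles; apply ex_CInt_ccont; try lra;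
      intros; apply cdiff_line_y, H; lra. }
  rewrite (Hx c), (Hx d), (Hy a), (Hy b) by lra. ring.
Qed.

(** An affine function has a primitive; here the integrals are simply computed. *)
Lemma rect_integral_affine (al be : C) (a b c d : R) :
  rect_integral (fun z => al + be * z)%C a b c d = 0%C.
Proof.
  unfold rect_integral.
  assert (E1 : forall y, CInt (fun x => al + be * ((x, y) : C))%C a b =
     CInt (fun x => (al + be * (Ci * RtoC y)) + be * RtoC x)%C a b).
  { intros y. f_equal. apply FunctionalExtensionality.functional_extensionality.
    intros x. rewrite pair_C. ring. }
  assert (E2 : forall x, CInt (fun y => al + be * ((x, y) : C))%C c d =
     CInt (fun y => (al + be * RtoC x) + (be * Ci) * RtoC y)%C c d).
  { intros x. f_equal. apply FunctionalExtensionality.functional_extensionality.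
    intros y. rewrite pair_C. ring. }
  rewrite !E1, !E2, !CInt_affine.
  ring.
Qed.

(** Goursat's proof.  It requires complex differentiability at each point only, not
    continuity of the derivative.  The property that is bisected is the bound
    eps (width + height)^2 on the integral: it is inherited from quarters, because the
    squares of the quarters add up, and it holds for small rectangles, because there
    the function is affine up to an error eps / 2 |z - z0|. *)
Theorem cauchy_rectangle (h : C -> C) (a b c d : R) :
  a <= b -> c <= d ->
  (forall x y, a <= x <= b -> c <= y <= d -> cdiff h (x, y)) ->
  rect_integral h a b c d = 0%C.
Proof.
  intros Hab Hcd H. apply Cmod_eq_0.
  enough (He : forall eps, 0 < eps ->
    Cmod (rect_integral h a b c d) <= eps * ((b - a) + (d - c)) ^ 2).
  { apply Rle_antisym; [|apply Cmod_ge_0]. apply Rnot_lt_le. intros Hpos.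
    set (s := (b - a) + (d - c)) in *.
    assert (Hs : 0 < s ^ 2 + 1) by (pose proof (pow2_ge_0 s); lra).
    specialize (He (Cmod (rect_integral h a b c d) / (2 * (s ^ 2 + 1)))
      ltac:(apply Rdiv_lt_0_compat; lra)).
    apply Rmult_le_compat_r with (r := 2 * (s ^ 2 + 1)) in He; [|lra].
    replace (Cmod (rect_integral h a b c d) / (2 * (s ^ 2 + 1)) * s ^ 2 * (2 * (s ^ 2 + 1)))
      with (Cmod (rect_integral h a b c d) * s ^ 2) in He by (field; lra).
    nra. }
  intros eps Heps.
  apply (rectangle_bisection (fun x x' y y' =>
    Cmod (rect_integral h x x' y y') <= eps * ((x' - x) + (y' - y)) ^ 2)); auto.
  - intros x x' y y' H1 H2 H3 H4 H5 H6 m n P1 P2 P3 P4.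
    rewrite (rect_integral_split h x x' y y' m n); [|unfold m; lra|unfold n; lra|].
    2: { intros; apply H; lra. }
    eapply Rle_trans; [apply Cmod_triangle|].
    eapply Rle_trans; [apply Rplus_le_compat_r, Cmod_triangle|].
    eapply Rle_trans; [apply Rplus_le_compat_r, Rplus_le_compat_r, Cmod_triangle|].
    replace (eps * (x' - x + (y' - y)) ^ 2) with
      (eps * (m - x + (n - y)) ^ 2 + eps * (x' - m + (n - y)) ^ 2
       + eps * (m - x + (y' - n)) ^ 2 + eps * (x' - m + (y' - n)) ^ 2)
      by (unfold m, n; field).
    lra.
  - intros u v Hu Hv. destruct (H u v Hu Hv) as [l Hl].
    destruct (is_cderive_eps h (u, v) l Hl (eps / 2) ltac:(lra)) as [del [Hd Hdel]].
    exists (del / 2). split; [lra|].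
    intros x x' y y' H1 H2 H3 H4 H5 H6 H7 H8.
    set (s := (x' - x) + (y' - y)).
    (* The first-order expansion of h at the point of accumulation. *)
    set (aff := fun z : C => (h (u, v) - (u, v) * l + l * z)%C).
    assert (Hrem : forall p q, x <= p <= x' -> y <= q <= y' ->
      Cmod (h (p, q) - aff (p, q)) <= eps / 2 * s).
    { intros p q Hp Hq.
      assert (Hz : Cmod ((p, q) - (u, v)) <= s).
      { eapply Rle_trans; [apply Cmod_le_sum|]. simpl. unfold s.
        apply Rplus_le_compat; apply Rabs_le; lra. }
      replace (h (p, q) - aff (p, q))%C
        with (h (p, q) - h (u, v) - ((p, q) - (u, v)) * l)%C by (unfold aff; ring).
      eapply Rle_trans; [apply Hdel; unfold s in Hz; lra|].
      apply Rmult_le_compat_l; lra. }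
    assert (Haff : forall z : C, cdiff aff z).
    { intros z. exists l. apply eps_is_cderive. intros e He. exists 1. split; [lra|].
      intros w _. replace (aff w - aff z - (w - z) * l)%C with (RtoC 0) by (unfold aff; ring).
      rewrite Cmod_0. apply Rmult_le_pos; [lra|apply Cmod_ge_0]. }
    assert (Hcx : forall q, y <= q <= y' -> ex_CInt (fun t => h (t, q)) x x' /\
      ex_CInt (fun t => aff (t, q)) x x').
    { intros q Hq. split; apply ex_CInt_ccont; try lra; intros t Ht; apply cdiff_line_x;
        [apply H; lra|apply Haff]. }
    assert (Hcy : forall p, x <= p <= x' -> ex_CInt (fun t => h (p, t)) y y' /\
      ex_CInt (fun t => aff (p, t)) y y').
    { intros p Hp. split; apply ex_CInt_ccont; try lra; intros t Ht; apply cdiff_line_y;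
        [apply H; lra|apply Haff]. }
    assert (HX : forall q, y <= q <= y' ->
      Cmod (CInt (fun t => h (t, q)) x x' - CInt (fun t => aff (t, q)) x x')
      <= (x' - x) * (eps / 2 * s)).
    { intros q Hq. destruct (Hcx q Hq). rewrite <- CInt_minus by assumption.
      apply CInt_norm_le_const; [lra| |intros; apply Hrem; lra].
      apply ex_CInt_minus; assumption. }
    assert (HY : forall p, x <= p <= x' ->
      Cmod (CInt (fun t => h (p, t)) y y' - CInt (fun t => aff (p, t)) y y')
      <= (y' - y) * (eps / 2 * s)).
    { intros q Hq. destruct (Hcy q Hq). rewrite <- CInt_minus by assumption.
      apply CInt_norm_le_const; [lra| |intros; apply Hrem; lra].
      apply ex_CInt_minus; assumption. }
    replace (rect_integral h x x' y y')
      with (rect_integral h x x' y y' - rect_integral aff x x' y y')%C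
      by (unfold aff; rewrite rect_integral_affine; ring).
    unfold rect_integral.
    match goal with |- Cmod (?h1 + Ci * ?h2 - ?h3 - Ci * ?h4 - (?a1 + Ci * ?a2 - ?a3 - Ci * ?a4)) <= _ =>
      replace (h1 + Ci * h2 - h3 - Ci * h4 - (a1 + Ci * a2 - a3 - Ci * a4))%C
      with ((h1 - a1) + Ci * (h2 - a2) + - (h3 - a3) + Ci * - (h4 - a4))%C by ring end.
    eapply Rle_trans; [apply Cmod_triangle|].
    eapply Rle_trans; [apply Rplus_le_compat_r, Cmod_triangle|].
    eapply Rle_trans; [apply Rplus_le_compat_r, Rplus_le_compat_r, Cmod_triangle|].
    rewrite !Cmod_mult, !Cmod_opp, Cmod_Ci, !Rmult_1_l.
    pose proof (HX y ltac:(lra)). pose proof (HX y' ltac:(lra)).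
    pose proof (HY x ltac:(lra)). pose proof (HY x' ltac:(lra)).
    replace (eps * s ^ 2) with ((x' - x) * (eps / 2 * s) + (y' - y) * (eps / 2 * s)
      + (x' - x) * (eps / 2 * s) + (y' - y) * (eps / 2 * s)) by (unfold s; field).
    lra.
Qed.

(** * Rules of complex differentiation and the complex exponential *)

Local Notation AC := (AbsRing_NormedModule C_AbsRing).

(** C carries two structures of normed module over itself, with the same operations and
    norm but different balls; the product rule speaks of one, analyticity of the other. *)
Lemma cdiff_absring (h : C -> C) (z : C) :
  cdiff h z <-> @ex_derive C_AbsRing AC h z.
Proof.
  split; intros [l [_ H]]; exists l; (split; [apply is_linear_scal_l|exact H]).
Qed.

Lemma cdiff_const (k z : C) : cdiff (fun _ => k) z.
Proof. apply (@ex_derive_const C_AbsRing C_NormedModule). Qed.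

Lemma cdiff_id (z : C) : cdiff (fun w => w) z.
Proof. apply cdiff_absring. apply (@ex_derive_id C_AbsRing). Qed.

Lemma cdiff_plus (f g : C -> C) (z : C) :
  cdiff f z -> cdiff g z -> cdiff (fun w => f w + g w)%C z.
Proof. apply (@ex_derive_plus C_AbsRing C_NormedModule). Qed.

Lemma cdiff_mult (f g : C -> C) (z : C) :
  cdiff f z -> cdiff g z -> cdiff (fun w => f w * g w)%C z.
Proof.
  rewrite !cdiff_absring. intros [lf Hf] [lg Hg]. eexists.
  apply (@is_derive_mult C_AbsRing f g z lf lg Hf Hg). exact Cmult_comm.
Qed.

Lemma cdiff_comp (f g : C -> C) (z : C) :
  cdiff f (g z) -> cdiff g z -> cdiff (fun w => f (g w)) z.
Proof.
  rewrite (cdiff_absring g). intros Hf Hg.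
  exact (@ex_derive_comp C_AbsRing C_NormedModule f g z Hf Hg).
Qed.

Lemma cdiff_Cinv (z : C) : z <> 0%C -> cdiff Cinv z.
Proof.
  intros Hz. pose proof (proj1 (Cmod_gt_0 z) Hz) as Hm.
  exists (- / (z * z))%C. apply eps_is_cderive. intros eps He.
  set (m := Cmod z) in *.
  assert (Hk : 0 < eps * m * m * m / 2)
    by (apply Rdiv_lt_0_compat; [repeat apply Rmult_lt_0_compat|]; lra).
  exists (Rmin (m / 2) (eps * m * m * m / 2)). split; [apply Rmin_pos; lra|].
  intros w Hw.
  assert (Hw1 : Cmod (w - z) < m / 2) by (eapply Rlt_le_trans; [apply Hw|apply Rmin_l]).
  assert (Hw2 : Cmod (w - z) < eps * m * m * m / 2) by (eapply Rlt_le_trans; [apply Hw|apply Rmin_r]).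
  assert (Hwm : m / 2 < Cmod w).
  { pose proof (Cmod_triangle w (- (w - z))) as Ht. rewrite Cmod_opp in Ht.
    replace (w + - (w - z))%C with z in Ht by ring. fold m in Ht. lra. }
  assert (Hw0 : w <> 0%C) by (apply Cmod_gt_0; lra).
  replace (/ w - / z - (w - z) * - / (z * z))%C
    with ((w - z) * ((w - z) * / (w * (z * z))))%C by (field; auto).
  rewrite !Cmod_mult, Cmod_inv by (repeat apply Cmult_neq_0; auto).
  rewrite !Cmod_mult. fold m. rewrite Rmult_comm.
  apply Rmult_le_compat_r; [apply Cmod_ge_0|].
  assert (Hden : 0 < Cmod w * (m * m)) by (repeat apply Rmult_lt_0_compat; lra).
  apply Rmult_le_reg_r with (Cmod w * (m * m)); [exact Hden|].
  rewrite Rmult_assoc, Rinv_l, Rmult_1_r by lra.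
  apply Rle_trans with (eps * (m / 2 * (m * m))); [lra|].
  apply Rmult_le_compat_l; [lra|]. apply Rmult_le_compat_r; [nra|lra].
Qed.

Lemma cdiff_div (f g : C -> C) (z : C) :
  cdiff f z -> cdiff g z -> g z <> 0%C -> cdiff (fun w => f w / g w)%C z.
Proof.
  intros Hf Hg H0. apply cdiff_mult; [exact Hf|].
  apply (cdiff_comp Cinv g); [apply cdiff_Cinv, H0|exact Hg].
Qed.

Lemma cdiff_conj (f : C -> C) (z : C) :
  cdiff f (Cconj z) -> cdiff (fun w => Cconj (f (Cconj w))) z.
Proof.
  intros [l Hl]. exists (Cconj l). apply eps_is_cderive. intros eps He.
  destruct (is_cderive_eps _ _ _ Hl eps He) as [del [Hd H]].
  exists del. split; [exact Hd|]. intros w Hw.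
  assert (E : (Cconj w - Cconj z = Cconj (w - z))%C)
    by (unfold Cconj, Cminus, Cplus, Copp; simpl; f_equal; ring).
  specialize (H (Cconj w)). rewrite E, Cmod_conj in H.
  replace (Cconj (f (Cconj w)) - Cconj (f (Cconj z)) - (w - z) * Cconj l)%C
    with (Cconj (f (Cconj w) - f (Cconj z) - Cconj (w - z) * l))
    by (unfold Cconj, Cminus, Cplus, Copp, Cmult; simpl; f_equal; ring).
  rewrite Cmod_conj. auto.
Qed.

Definition Cexp (z : C) : C := (exp (fst z) * cos (snd z), exp (fst z) * sin (snd z)).

Lemma Cexp_plus (z w : C) : Cexp (z + w) = (Cexp z * Cexp w)%C.
Proof.
  unfold Cexp, Cplus, Cmult; simpl. rewrite exp_plus, cos_plus, sin_plus. f_equal; ring.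
Qed.

Lemma Cmod_Cexp (z : C) : Cmod (Cexp z) = exp (fst z).
Proof.
  unfold Cmod, Cexp; cbn [fst snd].
  replace ((exp (fst z) * cos (snd z)) ^ 2 + (exp (fst z) * sin (snd z)) ^ 2)
    with (exp (fst z) * exp (fst z) * ((sin (snd z))² + (cos (snd z))²)) by (unfold Rsqr; ring).
  rewrite sin2_cos2, Rmult_1_r. apply sqrt_square, Rlt_le, exp_pos.
Qed.

Lemma real_derive_eps (g : R -> R) (l : R) :
  is_derive g 0 l -> forall eps, 0 < eps -> exists del, 0 < del /\
    forall t, Rabs t < del -> Rabs (g t - g 0 - t * l) <= eps * Rabs t.
Proof.
  intros [_ H] eps He.
  destruct (H 0 (fun P HP => HP) (mkposreal eps He)) as [del Hdel].
  exists del. split; [apply cond_pos|]. intros t Ht.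
  assert (E : ball 0 del t) by (unfold ball; simpl; unfold AbsRing_ball, abs, minus, plus, opp; simpl;
    rewrite Ropp_0, Rplus_0_r; exact Ht).
  specialize (Hdel t E).
  unfold norm, minus, plus, opp, scal in Hdel; simpl in Hdel. unfold abs, mult in Hdel; simpl in Hdel.
  rewrite Ropp_0, Rplus_0_r in Hdel. exact Hdel.
Qed.

(** By the functional equation it suffices to expand at 0, where the components of
    e^{x + i y} - 1 - (x + i y) are controlled by the derivatives of exp, sin and cos
    at 0. *)
Lemma cdiff_Cexp (z : C) : cdiff Cexp z.
Proof.
  exists (Cexp z). apply eps_is_cderive. intros eps He.
  set (e := exp (fst z)). assert (Hepos : 0 < e) by apply exp_pos.
  (* The error terms below add up to at most 8 eta |k|, to be multiplied by |e^z|. *)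
  set (eta := Rmin 1 (eps / (8 * e))).
  assert (Heta : 0 < eta) by (apply Rmin_pos; [lra|apply Rdiv_lt_0_compat; lra]).
  assert (Heta1 : eta <= 1) by apply Rmin_l.
  assert (Heta2 : 8 * eta * e <= eps).
  { pose proof (Rmin_r 1 (eps / (8 * e))) as Hr. fold eta in Hr.
    apply Rmult_le_compat_r with (r := 8 * e) in Hr; [|lra].
    unfold Rdiv in Hr. rewrite Rmult_assoc, Rinv_l in Hr; lra. }
  clearbody eta.
  destruct (real_derive_eps exp 1) with (eps := eta) as [d1 [Hd1 H1]];
    [auto_derive; [easy|rewrite exp_0; ring]|lra|].
  destruct (real_derive_eps sin 1) with (eps := eta) as [d2 [Hd2 H2]];
    [auto_derive; [easy|rewrite cos_0; ring]|lra|].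
  destruct (real_derive_eps cos 0) with (eps := eta) as [d3 [Hd3 H3]];
    [auto_derive; [easy|rewrite sin_0; ring]|lra|].
  set (d := Rmin (Rmin 1 eta) (Rmin d1 (Rmin d2 d3))).
  exists d. split; [unfold d; repeat apply Rmin_pos; lra|].
  intros w Hw. set (k := (w - z)%C) in *.
  replace w with (z + k)%C by (unfold k; ring). rewrite Cexp_plus.
  replace (Cexp z * Cexp k - Cexp z - k * Cexp z)%C with (Cexp z * (Cexp k - 1 - k))%C by ring.
  rewrite Cmod_mult, Cmod_Cexp. fold e.
  assert (Hd : d <= 1 /\ d <= eta /\ d <= d1 /\ d <= d2 /\ d <= d3).
  { unfold d. pose proof (Rmin_l (Rmin 1 eta) (Rmin d1 (Rmin d2 d3))).
    pose proof (Rmin_r (Rmin 1 eta) (Rmin d1 (Rmin d2 d3))).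
    pose proof (Rmin_l 1 eta). pose proof (Rmin_r 1 eta).
    pose proof (Rmin_l d1 (Rmin d2 d3)). pose proof (Rmin_r d1 (Rmin d2 d3)).
    pose proof (Rmin_l d2 d3). pose proof (Rmin_r d2 d3). lra. }
  pose proof (Cmod_fst k) as Hk1. pose proof (Cmod_snd k) as Hk2.
  destruct k as [x y]. cbn [fst snd] in Hk1, Hk2. set (c := Cmod (x, y)) in *.
  specialize (H1 x ltac:(lra)). specialize (H2 y ltac:(lra)). specialize (H3 y ltac:(lra)).
  rewrite exp_0 in H1. rewrite sin_0 in H2. rewrite cos_0 in H3.
  set (A := exp x - 1 - x * 1) in *. set (B := sin y - 0 - y * 1) in *. set (D := cos y - 1 - y * 0) in *.
  assert (HA : Rabs A <= eta * c) by nra. assert (HB : Rabs B <= eta * c) by nra.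
  assert (HD : Rabs D <= eta * c) by nra.
  assert (Hc : c < d) by exact Hw.
  assert (Hc0 : 0 <= c) by apply Cmod_ge_0.
  assert (HS : Cmod (Cexp (x, y) - 1 - (x, y)) <= 8 * eta * c).
  { eapply Rle_trans; [apply Cmod_le_sum|].
    replace (fst (Cexp (x, y) - 1 - (x, y))%C) with (A * cos y + (1 + x) * D)
      by (unfold A, D; simpl; ring).
    replace (snd (Cexp (x, y) - 1 - (x, y))%C) with (A * sin y + (1 + x) * B + x * y)
      by (unfold A, B; simpl; ring).
    assert (Ht : Rabs (A * cos y) <= eta * c).
    { rewrite Rabs_mult. pose proof (Rabs_pos A).
      assert (Rabs (cos y) <= 1) by (apply Rabs_le, COS_bound). nra. }
    assert (Ht2 : Rabs (A * sin y) <= eta * c).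
    { rewrite Rabs_mult. pose proof (Rabs_pos A).
      assert (Rabs (sin y) <= 1) by (apply Rabs_le, SIN_bound). nra. }
    assert (Hx2 : Rabs (1 + x) <= 2).
    { eapply Rle_trans; [apply Rabs_triang|]. rewrite Rabs_R1. lra. }
    assert (Ht3 : Rabs ((1 + x) * D) <= 2 * (eta * c)).
    { rewrite Rabs_mult. pose proof (Rabs_pos D). pose proof (Rabs_pos (1 + x)). nra. }
    assert (Ht4 : Rabs ((1 + x) * B) <= 2 * (eta * c)).
    { rewrite Rabs_mult. pose proof (Rabs_pos B). pose proof (Rabs_pos (1 + x)). nra. }
    assert (Ht5 : Rabs (x * y) <= eta * c).
    { rewrite Rabs_mult. pose proof (Rabs_pos x). pose proof (Rabs_pos y). nra. }
    pose proof (Rabs_triang (A * cos y) ((1 + x) * D)).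
    pose proof (Rabs_triang (A * sin y + (1 + x) * B) (x * y)).
    pose proof (Rabs_triang (A * sin y) ((1 + x) * B)).
    assert (0 <= eta * c) by (apply Rmult_le_pos; lra). lra. }
  apply Rle_trans with (e * (8 * eta * c)); [apply Rmult_le_compat_l; [lra|exact HS]|].
  replace (e * (8 * eta * c)) with (8 * eta * e * c) by ring.
  apply Rmult_le_compat_r; lra.
Qed.

(** * The damped logarithmic derivative *)

(** The quotient of these is sigma(i z), the factor of the phase that depends on p. *)
Definition tau_num (p : R) (z : C) : C := (RtoC p + Ci * z)%C.
Definition tau_den (p : R) (z : C) : C := (RtoC p + - Ci * z)%C.

(** The function w: its values on the real axis have modulus 1, and w = 1 is the
    equation tan(pi x) = - x / p. *)
Definition phase (p : R) (z : C) : C :=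
  (Cexp (RtoC (2 * PI) * Ci * z) * (tau_num p z / tau_den p z))%C.

(** The derivative of [phase], written out. *)
Definition phase_deriv (p : R) (z : C) : C :=
  (Cexp (RtoC (2 * PI) * Ci * z) *
   (RtoC (2 * PI) * Ci * (tau_num p z / tau_den p z)
    + RtoC (2 * p) * Ci / (tau_den p z * tau_den p z)))%C.

(** Minus the logarithmic derivative of 1 - r w.  For r = 1 its poles in the closed
    first quadrant are 0 and the lambda_n; for 0 <= r < 1 there are none. *)
Definition log_kernel (p r : R) (z : C) : C :=
  (RtoC r * phase_deriv p z / (1 + RtoC (- r) * phase p z))%C.

(** The continuous argument of w on the real axis. *)
Definition theta (p x : R) : R := 2 * PI * x + 2 * atan (x / p).
Definition dtheta (p x : R) : R := 2 * PI + 2 * p / (p ^ 2 + x ^ 2).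
Definition poisson (r th : R) : R := (1 - r ^ 2) / (1 - 2 * r * cos th + r ^ 2).

(** The function w at i t, that is e^{-2 pi t} sigma(-t). *)
Definition axis_phase (p t : R) : R := exp (- 2 * PI * t) * ((p - t) / (p + t)).

(** Minus the t-derivative of [axis_phase]. *)
Definition axis_rate (p t : R) : R :=
  exp (- 2 * PI * t) * (2 * PI * ((p - t) / (p + t)) + 2 * p / (p + t) ^ 2).

(** The kernel of the second integral, damped by r; see [koshliakov_kernel] for
    r = 1. *)
Definition axis_kernel (p r t : R) : R :=
  r * axis_rate p t / (2 * PI * (1 - r * axis_phase p t)).

Section kernel.
Variable p : R.
Hypothesis Hp : 0 < p.

Lemma Cmod_sqr (z : C) : Cmod z ^ 2 = fst z ^ 2 + snd z ^ 2.
Proof. exact (Cmod2_alt z). Qed.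

Lemma tau_den_ge (x y : R) : 0 <= y -> p <= Cmod (tau_den p (x, y)).
Proof.
  intros Hy. eapply Rle_trans; [|apply Cmod_fst].
  eapply Rle_trans; [|apply Rle_abs]. unfold tau_den. simpl. lra.
Qed.

Lemma tau_den_neq0 (x y : R) : 0 <= y -> tau_den p (x, y) <> 0%C.
Proof. intros Hy. apply Cmod_gt_0. pose proof (tau_den_ge x y Hy). lra. Qed.

(** For y >= 0 the point i p is at least as near to (x, y) as - i p is. *)
Lemma tau_num_le_den (x y : R) :
  0 <= y -> Cmod (tau_num p (x, y)) <= Cmod (tau_den p (x, y)).
Proof.
  intros Hy. apply Rsqr_incr_0_var; [|apply Cmod_ge_0].
  rewrite !Rsqr_pow2, !Cmod_sqr. unfold tau_num, tau_den; simpl. nra.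
Qed.

Lemma tau_le_1 (x y : R) : 0 <= y -> Cmod (tau_num p (x, y) / tau_den p (x, y)) <= 1.
Proof.
  intros Hy. rewrite Cmod_div by (apply tau_den_neq0; auto).
  pose proof (tau_den_ge x y Hy). pose proof (tau_num_le_den x y Hy).
  apply Rmult_le_reg_r with (Cmod (tau_den p (x, y))); [lra|].
  unfold Rdiv. rewrite Rmult_assoc, Rinv_l; lra.
Qed.

Lemma Cmod_exp_2PIi (x y : R) : Cmod (Cexp (RtoC (2 * PI) * Ci * (x, y))) = exp (- 2 * PI * y).
Proof. rewrite Cmod_Cexp. f_equal. simpl. ring. Qed.

Lemma phase_le (x y : R) : 0 <= y -> Cmod (phase p (x, y)) <= exp (- 2 * PI * y).
Proof.
  intros Hy. unfold phase. rewrite Cmod_mult, Cmod_exp_2PIi.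
  pose proof (tau_le_1 x y Hy). pose proof (exp_pos (- 2 * PI * y)). nra.
Qed.

Lemma phase_deriv_le (x y : R) : 0 <= y ->
  Cmod (phase_deriv p (x, y)) <= exp (- 2 * PI * y) * (2 * PI + 2 / p).
Proof.
  intros Hy. unfold phase_deriv. rewrite Cmod_mult, Cmod_exp_2PIi.
  apply Rmult_le_compat_l; [apply Rlt_le, exp_pos|].
  eapply Rle_trans; [apply Cmod_triangle|].
  pose proof PI_RGT_0 as Hpi. pose proof (tau_den_ge x y Hy) as Hu.
  rewrite Cmod_div by (apply Cmult_neq_0; apply tau_den_neq0; auto).
  rewrite !Cmod_mult, Cmod_Ci, !Cmod_R, !Rabs_pos_eq by lra.
  apply Rplus_le_compat.
  - pose proof (tau_le_1 x y Hy) as H1. nra.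
  - set (m := Cmod (tau_den p (x, y))) in *.
    apply Rmult_le_reg_r with (p * (m * m)); [repeat apply Rmult_lt_0_compat; lra|].
    replace (2 * p * 1 / (m * m) * (p * (m * m))) with (2 * (p * p)) by (field; lra).
    replace (2 / p * (p * (m * m))) with (2 * (m * m)) by (field; lra). nra.
Qed.

Lemma log_kernel_den_neq0 (r x y : R) :
  0 <= r < 1 -> 0 <= y -> (1 + RtoC (- r) * phase p (x, y))%C <> 0%C.
Proof.
  intros Hr Hy H.
  assert (E : (RtoC r * phase p (x, y))%C = 1%C).
  { replace (RtoC r * phase p (x, y))%C with (1 - (1 + RtoC (- r) * phase p (x, y)))%C
      by (rewrite RtoC_opp; ring). rewrite H. ring. }
  apply (f_equal Cmod) in E. rewrite Cmod_mult, Cmod_1, Cmod_R, Rabs_pos_eq in E by lra.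
  pose proof (phase_le x y Hy). pose proof PI_RGT_0.
  assert (exp (- 2 * PI * y) <= 1).
  { rewrite <- exp_0. destruct (Req_dec y 0) as [->|]; [right; f_equal; ring|].
    left. apply exp_increasing. nra. }
  pose proof (Cmod_ge_0 (phase p (x, y))). nra.
Qed.

Lemma exp_top (y : R) : 1 <= y -> exp (- 2 * PI * y) <= 1 / 2.
Proof.
  intros Hy. pose proof PI_RGT_0. pose proof PI2_1.
  assert (H1 : - 2 * PI * y <= - 1) by nra.
  apply Rle_trans with (exp (- (1))).
  { destruct H1 as [H1|H1]; [left; apply exp_increasing; lra|right; f_equal; lra]. }
  rewrite exp_Ropp. pose proof (exp_ineq1 1 ltac:(lra)).
  apply Rmult_le_reg_r with (exp 1); [lra|]. rewrite Rinv_l; lra.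
Qed.

Lemma log_kernel_den_ge_top (r x y : R) : 0 <= r < 1 -> 1 <= y ->
  1 / 2 <= Cmod (1 + RtoC (- r) * phase p (x, y)).
Proof.
  intros Hr Hy. pose proof (phase_le x y ltac:(lra)). pose proof (exp_top y Hy).
  set (w := phase p (x, y)) in *.
  pose proof (Cmod_triangle (1 + RtoC (- r) * w) (RtoC r * w)) as Ht.
  replace (1 + RtoC (- r) * w + RtoC r * w)%C with (RtoC 1) in Ht by (rewrite RtoC_opp; ring).
  rewrite Cmod_1, (Cmod_mult (RtoC r)), Cmod_R, Rabs_pos_eq in Ht by lra.
  pose proof (Cmod_ge_0 w). nra.
Qed.

Lemma cos_2PI_nat (n : nat) : cos (2 * PI * INR n) = 1.
Proof.
  rewrite <- cos_0. replace (2 * PI * INR n) with (0 + 2 * INR n * PI) by ring. apply cos_period.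
Qed.

Lemma sin_2PI_nat (n : nat) : sin (2 * PI * INR n) = 0.
Proof.
  rewrite <- sin_0. replace (2 * PI * INR n) with (0 + 2 * INR n * PI) by ring. apply sin_period.
Qed.

(** At an integer abscissa e^{2 pi i z} is real and positive, so the sign of Re w is
    that of p^2 - |z|^2, which is nonpositive as soon as the abscissa is at least p. *)
Lemma log_kernel_den_ge_right (r y : R) (n : nat) : 0 <= r < 1 -> p <= INR n -> 0 <= y ->
  1 <= Cmod (1 + RtoC (- r) * phase p (INR n, y)).
Proof.
  intros Hr Hn Hy. eapply Rle_trans; [|apply Cmod_fst].
  eapply Rle_trans; [|apply Rle_abs].
  set (D := (p + y) ^ 2 + INR n ^ 2).
  assert (HD : 0 < D) by (unfold D; nra).
  assert (E : phase p (INR n, y) =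
    (exp (- 2 * PI * y) * (p ^ 2 - y ^ 2 - INR n ^ 2) / D,
     exp (- 2 * PI * y) * (2 * p * INR n) / D)).
  { unfold phase, Cexp. cbn [fst snd Cmult RtoC Ci].
    replace ((2 * PI * 0 - 0 * 1) * INR n - (2 * PI * 1 + 0 * 0) * y) with (- 2 * PI * y) by ring.
    replace ((2 * PI * 0 - 0 * 1) * y + (2 * PI * 1 + 0 * 0) * INR n) with (2 * PI * INR n) by ring.
    rewrite cos_2PI_nat, sin_2PI_nat.
    unfold tau_num, tau_den, Cdiv, Cinv, Cmult, Cplus, Copp, Ci, RtoC; cbn [fst snd].
    unfold D in *. f_equal; field; nra. }
  rewrite E. simpl fst.
  assert (exp (- 2 * PI * y) * (p * (p * 1) - y * (y * 1) - INR n * (INR n * 1)) / D <= 0).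
  { pose proof (exp_pos (- 2 * PI * y)). apply Rmult_le_reg_r with D; [lra|].
    unfold Rdiv. rewrite Rmult_assoc, Rinv_l by lra. rewrite Rmult_0_l, Rmult_1_r.
    assert (p * p <= INR n * INR n) by nra. nra. }
  simpl in *. nra.
Qed.

(** The bound 2 pi + 2 / p for |w'| e^{2 pi y}, divided by the bound 1 / 2 for
    |1 - r w|. *)
Definition kernel_const : R := 2 * (2 * PI + 2 / p).

Lemma kernel_const_pos : 0 < kernel_const.
Proof.
  unfold kernel_const. pose proof PI_RGT_0. assert (0 < 2 / p) by (apply Rdiv_lt_0_compat; lra). lra.
Qed.

Lemma log_kernel_le (r x y : R) : 0 <= r < 1 -> 0 <= y ->
  1 / 2 <= Cmod (1 + RtoC (- r) * phase p (x, y)) ->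
  Cmod (log_kernel p r (x, y)) <= kernel_const * exp (- 2 * PI * y).
Proof.
  intros Hr Hy Hd. unfold log_kernel. rewrite Cmod_div by (apply log_kernel_den_neq0; auto).
  rewrite Cmod_mult, Cmod_R, Rabs_pos_eq by lra.
  pose proof (phase_deriv_le x y Hy) as Hw. pose proof (Cmod_ge_0 (phase_deriv p (x, y))).
  set (m := Cmod (1 + RtoC (- r) * phase p (x, y))) in *.
  apply Rmult_le_reg_r with m; [lra|]. unfold Rdiv. rewrite Rmult_assoc, Rinv_l, Rmult_1_r by lra.
  unfold kernel_const. set (q := 2 * PI + 2 / p) in *. set (e := exp (- 2 * PI * y)) in *. nra.
Qed.

Lemma cdiff_log_kernel (r x y : R) : 0 <= r < 1 -> 0 <= y -> cdiff (log_kernel p r) (x, y).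
Proof.
  intros Hr Hy.
  assert (HE : cdiff (fun z => Cexp (RtoC (2 * PI) * Ci * z)) (x, y)).
  { apply (cdiff_comp Cexp); [apply cdiff_Cexp|].
    apply cdiff_mult; [apply cdiff_const|apply cdiff_id]. }
  assert (Hup : cdiff (tau_num p) (x, y)).
  { apply cdiff_plus; [apply cdiff_const|]. apply cdiff_mult; [apply cdiff_const|apply cdiff_id]. }
  assert (Hum : cdiff (tau_den p) (x, y)).
  { apply cdiff_plus; [apply cdiff_const|]. apply cdiff_mult; [apply cdiff_const|apply cdiff_id]. }
  assert (H0 := tau_den_neq0 x y Hy).
  unfold log_kernel. apply cdiff_div.
  - apply cdiff_mult; [apply cdiff_const|]. apply cdiff_mult; [exact HE|].
    apply cdiff_plus.
    + apply cdiff_mult; [apply cdiff_const|]. apply cdiff_div; assumption.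
    + apply cdiff_div; [apply cdiff_const| |apply Cmult_neq_0; assumption].
      apply cdiff_mult; assumption.
  - apply cdiff_plus; [apply cdiff_const|]. apply cdiff_mult; [apply cdiff_const|].
    apply cdiff_mult; [exact HE|]. apply cdiff_div; assumption.
  - apply log_kernel_den_neq0; auto.
Qed.

Lemma cos_2atan (s : R) : cos (2 * atan s) = (1 - s ^ 2) / (1 + s ^ 2).
Proof.
  rewrite cos_2a, cos_atan, sin_atan.
  assert (0 < 1 + s²) by (pose proof (Rle_0_sqr s); lra).
  assert (H1 : sqrt (1 + s²) * sqrt (1 + s²) = 1 + s²) by (apply sqrt_sqrt; lra).
  assert (sqrt (1 + s²) <> 0) by (apply Rgt_not_eq, sqrt_lt_R0; lra).
  replace (1 / sqrt (1 + s²) * (1 / sqrt (1 + s²)) - s / sqrt (1 + s²) * (s / sqrt (1 + s²)))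
    with ((1 - s ^ 2) / (sqrt (1 + s²) * sqrt (1 + s²))) by (field; auto).
  rewrite H1. unfold Rsqr. f_equal. f_equal. ring.
Qed.

Lemma sin_2atan (s : R) : sin (2 * atan s) = 2 * s / (1 + s ^ 2).
Proof.
  rewrite sin_2a, cos_atan, sin_atan.
  assert (0 < 1 + s²) by (pose proof (Rle_0_sqr s); lra).
  assert (H1 : sqrt (1 + s²) * sqrt (1 + s²) = 1 + s²) by (apply sqrt_sqrt; lra).
  assert (sqrt (1 + s²) <> 0) by (apply Rgt_not_eq, sqrt_lt_R0; lra).
  replace (2 * (s / sqrt (1 + s²)) * (1 / sqrt (1 + s²)))
    with (2 * s / (sqrt (1 + s²) * sqrt (1 + s²))) by (field; auto).
  rewrite H1. unfold Rsqr. f_equal. f_equal. ring.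
Qed.

Lemma phase_real (x : R) : phase p (x, 0) = (cos (theta p x), sin (theta p x)).
Proof.
  unfold theta. rewrite cos_plus, sin_plus, cos_2atan, sin_2atan.
  unfold phase, Cexp. cbn [fst snd Cmult RtoC Ci].
  replace ((2 * PI * 0 - 0 * 1) * x - (2 * PI * 1 + 0 * 0) * 0) with 0 by ring.
  replace ((2 * PI * 0 - 0 * 1) * 0 + (2 * PI * 1 + 0 * 0) * x) with (2 * PI * x) by ring.
  rewrite exp_0.
  unfold tau_num, tau_den, Cdiv, Cinv, Cmult, Cplus, Copp, Ci, RtoC; cbn [fst snd].
  f_equal; field; nra.
Qed.

Lemma phase_deriv_real (x : R) :
  phase_deriv p (x, 0) = (RtoC (dtheta p x) * Ci * phase p (x, 0))%C.
Proof.
  unfold phase_deriv, phase. set (E := Cexp _). clearbody E. destruct E as [e1 e2]. unfold dtheta.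
  unfold tau_num, tau_den, Cdiv, Cinv, Cmult, Cplus, Copp, Ci, RtoC; cbn [fst snd].
  f_equal; field; (split; [nra|]);
    (replace ((p * p - -1 * x * (-1 * x)) ^ 2 + (p * (-1 * x) + -1 * x * p) ^ 2)
       with ((p ^ 2 + x ^ 2) ^ 2) by ring); apply pow_nonzero; nra.
Qed.

Lemma poisson_den_pos (r th : R) : 0 <= r < 1 -> 0 < 1 - 2 * r * cos th + r ^ 2.
Proof. intros Hr. pose proof (COS_bound th). nra. Qed.

(** P_r(theta) - 1 = 2 Re (r w / (1 - r w)), and w' = i theta' w on the real axis. *)
Lemma log_kernel_real (r x : R) : 0 <= r < 1 ->
  (RtoC (dtheta p x * (poisson r (theta p x) - 1))
   = - Ci * log_kernel p r (x, 0) + Cconj (- Ci * log_kernel p r (x, 0)))%C.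
Proof.
  intros Hr. unfold log_kernel. rewrite phase_deriv_real, phase_real.
  pose proof (poisson_den_pos r (theta p x) Hr) as Hd. unfold poisson.
  pose proof (sin2_cos2 (theta p x)) as Hsc. unfold Rsqr in Hsc.
  set (c := cos (theta p x)) in *. set (s := sin (theta p x)) in *. set (k := dtheta p x).
  assert (HD : (1 - r * c) ^ 2 + (r * s) ^ 2 = 1 - 2 * r * c + r ^ 2).
  { transitivity (1 - 2 * r * c + r ^ 2 * (s * s + c * c)); [ring|rewrite Hsc; ring]. }
  unfold Cdiv, Cinv, Cmult, Cplus, Copp, Cconj, Ci, RtoC; cbn [fst snd].
  match goal with |- context [ ?a / ((?q1) ^ 2 + (?q2) ^ 2) ] =>
    replace (q1 ^ 2 + q2 ^ 2) with (1 - 2 * r * c + r ^ 2) by (rewrite <- HD; ring) end.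
  set (D := 1 - 2 * r * c + r ^ 2) in *.
  f_equal; [|field; lra].
  apply Rmult_eq_reg_r with D; [|lra]. unfold Rdiv.
  replace (k * ((1 - r ^ 2) * / D - 1) * D) with (k * ((1 - r ^ 2) - D)) by (field; lra).
  field_simplify_eq; [|lra].
  replace (s ^ 2) with (1 - c ^ 2) by (rewrite <- Hsc; ring).
  unfold D. ring.
Qed.

(** On the imaginary axis w is real, and d/dz = - i d/dt makes w' purely imaginary. *)
Lemma log_kernel_imag (r t : R) : 0 <= r < 1 -> 0 <= t ->
  log_kernel p r (0, t) = (RtoC (2 * PI * axis_kernel p r t) * Ci)%C.
Proof.
  intros Hr Ht.
  assert (E1 : phase p (0, t) = RtoC (axis_phase p t)).
  { unfold phase, Cexp, axis_phase. cbn [fst snd Cmult RtoC Ci].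
    replace ((2 * PI * 0 - 0 * 1) * 0 - (2 * PI * 1 + 0 * 0) * t) with (- 2 * PI * t) by ring.
    replace ((2 * PI * 0 - 0 * 1) * t + (2 * PI * 1 + 0 * 0) * 0) with 0 by ring.
    rewrite cos_0, sin_0.
    unfold tau_num, tau_den, Cdiv, Cinv, Cmult, Cplus, Copp, Ci, RtoC; cbn [fst snd].
    f_equal; field; nra. }
  assert (E2 : phase_deriv p (0, t) = (RtoC (axis_rate p t) * Ci)%C).
  { unfold phase_deriv, Cexp, axis_rate. cbn [fst snd Cmult RtoC Ci].
    replace ((2 * PI * 0 - 0 * 1) * 0 - (2 * PI * 1 + 0 * 0) * t) with (- 2 * PI * t) by ring.
    replace ((2 * PI * 0 - 0 * 1) * t + (2 * PI * 1 + 0 * 0) * 0) with 0 by ring.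
    rewrite cos_0, sin_0.
    unfold tau_num, tau_den, Cdiv, Cinv, Cmult, Cplus, Copp, Ci, RtoC; cbn [fst snd].
    f_equal; field; nra. }
  pose proof (log_kernel_den_neq0 r 0 t Hr Ht) as Hd. unfold log_kernel, axis_kernel. rewrite E1, E2 in *.
  assert (Hd' : 1 - r * axis_phase p t <> 0).
  { intros H. apply Hd. unfold RtoC, Cplus, Cmult; simpl. f_equal; [lra|ring]. }
  pose proof PI_RGT_0.
  unfold Cdiv, Cinv, Cmult, Cplus, Copp, Ci, RtoC; cbn [fst snd].
  f_equal; field; repeat split; try nra.
  all: try lra.
Qed.
End kernel.

(** * Moving the contour from the real to the imaginary axis *)

Lemma ccont_Cmod (g : R -> C) (x : R) : ccont g x -> continuous (fun t => Cmod (g t)) x.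
Proof.
  intros H.
  apply (continuous_ext (fun t => @norm R_AbsRing C_R_NormedModule (g t))).
  - intros t. symmetry. apply Cmod_norm.
  - apply (continuous_comp (V := C_UniformSpace) g (@norm R_AbsRing C_R_NormedModule)); [exact H|].
    apply (@filterlim_norm R_AbsRing C_R_NormedModule).
Qed.

Lemma continuous_exp_lin (k x : R) : continuous (fun y => exp (k * y)) x.
Proof. apply (ex_derive_continuous (fun y => exp (k * y))). auto_derive; exact I. Qed.

Section contour.
Variables (p : R) (Hp : 0 < p).

(** Cauchy's theorem for h g_r on [0, n] x [0, T]: the difference of the integrals
    along the two axes is made of the integrals along the top and right sides, where
    |g_r| <= C e^{-2 pi y} with C independent of r. *)
Lemma contour_quadrant (h : C -> C) (r T M1 M2 : R) (n : nat) :
  0 <= r < 1 -> p <= INR n -> 1 <= T ->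
  (forall x y, 0 <= x -> 0 <= y -> cdiff h (x, y)) ->
  (forall x, 0 <= x <= INR n -> Cmod (h (x, T)) * exp (- 2 * PI * T) <= M1) ->
  RInt (fun y => exp (- 2 * PI * y) * Cmod (h (INR n, y))) 0 T <= M2 ->
  Cmod (CInt (fun x => h (x, 0) * log_kernel p r (x, 0))%C 0 (INR n)
        - Ci * CInt (fun y => h (0, y) * log_kernel p r (0, y))%C 0 T)
  <= kernel_const p * (INR n * M1 + M2).
Proof.
  intros Hr Hn HT Hh HM1 HM2.
  assert (Hn0 : 0 <= INR n) by lra.
  set (F := fun z => (h z * log_kernel p r z)%C).
  assert (HF : forall x y, 0 <= x -> 0 <= y -> cdiff F (x, y)).
  { intros x y Hx Hy. apply cdiff_mult; [auto|apply cdiff_log_kernel; auto]. }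
  pose proof (cauchy_rectangle F 0 (INR n) 0 T Hn0 ltac:(lra)
    (fun x y Hx Hy => HF x y (proj1 Hx) (proj1 Hy))) as Hc.
  unfold rect_integral in Hc.
  pose proof (kernel_const_pos p Hp) as HC0.
  assert (Htop : Cmod (CInt (fun x => F (x, T)) 0 (INR n)) <= (INR n - 0) * (kernel_const p * M1)).
  { apply CInt_norm_le_const; [lra| |].
    - apply ex_CInt_ccont; [lra|]. intros x Hx. apply cdiff_line_x, HF; lra.
    - intros x Hx. unfold F. rewrite Cmod_mult.
      pose proof (log_kernel_le p Hp r x T Hr ltac:(lra) (log_kernel_den_ge_top p Hp r x T Hr HT)) as Hg.
      specialize (HM1 x Hx). pose proof (Cmod_ge_0 (h (x, T))).
      apply Rle_trans with (Cmod (h (x, T)) * (kernel_const p * exp (- 2 * PI * T))).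
      + apply Rmult_le_compat_l; assumption.
      + replace (Cmod (h (x, T)) * (kernel_const p * exp (- 2 * PI * T)))
          with (kernel_const p * (Cmod (h (x, T)) * exp (- 2 * PI * T))) by ring.
        apply Rmult_le_compat_l; lra. }
  assert (Hex : ex_RInt (fun y => exp (- 2 * PI * y) * Cmod (h (INR n, y))) 0 T).
  { apply (ex_RInt_continuous (V := R_CompleteNormedModule)). intros y Hy.
    rewrite Rmin_left, Rmax_right in Hy by lra.
    apply (continuous_mult (K := R_AbsRing)); [apply continuous_exp_lin|].
    apply (ccont_Cmod (fun y => h (INR n, y))). apply cdiff_line_y, Hh; lra. }
  assert (Hright : Cmod (CInt (fun y => F (INR n, y)) 0 T) <= kernel_const p * M2).
  { apply Rle_trans with (RInt (fun y => kernel_const p * (exp (- 2 * PI * y) * Cmod (h (INR n, y)))) 0 T).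
    - apply CInt_norm_le; [lra| | |].
      + apply ex_CInt_ccont; [lra|]. intros y Hy. apply cdiff_line_y, HF; lra.
      + apply (ex_RInt_scal (V := R_NormedModule)). exact Hex.
      + intros y Hy. unfold F. rewrite Cmod_mult.
        pose proof (log_kernel_le p Hp r (INR n) y Hr ltac:(lra)
          ltac:(pose proof (log_kernel_den_ge_right p Hp r y n Hr Hn ltac:(lra)); lra)) as Hg.
        pose proof (Cmod_ge_0 (h (INR n, y))).
        replace (kernel_const p * (exp (- 2 * PI * y) * Cmod (h (INR n, y))))
          with (Cmod (h (INR n, y)) * (kernel_const p * exp (- 2 * PI * y))) by ring.
        apply Rmult_le_compat_l; assumption.
    - assert (E : RInt (fun y => kernel_const p * (exp (- 2 * PI * y) * Cmod (h (INR n, y)))) 0 T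
        = kernel_const p * RInt (fun y => exp (- 2 * PI * y) * Cmod (h (INR n, y))) 0 T)
        by exact (RInt_scal (V := R_CompleteNormedModule) _ 0 T (kernel_const p) Hex).
      rewrite E. apply Rmult_le_compat_l; lra. }
  change (Cmod (CInt (fun x => F (x, 0)) 0 (INR n) - Ci * CInt (fun y => F (0, y)) 0 T)
          <= kernel_const p * (INR n * M1 + M2)).
  replace (CInt (fun x => F (x, 0)) 0 (INR n) - Ci * CInt (fun y => F (0%R, y)) 0 T)%C
    with (CInt (fun x => F (x, T)) 0 (INR n) - Ci * CInt (fun y => F (INR n, y)) 0 T)%C.
  2: { match type of Hc with (?a + Ci * ?b - ?c - Ci * ?d = _)%C =>
         transitivity ((a - Ci * d) - (a + Ci * b - c - Ci * d))%C;
         [ring|rewrite Hc; ring] end. }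
  unfold Cminus. eapply Rle_trans; [apply Cmod_triangle|].
  rewrite Cmod_opp, Cmod_mult, Cmod_Ci, Rmult_1_l. lra.
Qed.

(** The Schwarz reflection of f; it carries the values of f in the lower half plane to
    the upper one and preserves holomorphy. *)
Definition reflect (f : C -> C) (z : C) : C := Cconj (f (Cconj z)).

Lemma reflect_pair (f : C -> C) (x y : R) : reflect f (x, y) = Cconj (f (x, - y)).
Proof. reflexivity. Qed.

Lemma Cconj_mult (z w : C) : Cconj (z * w) = (Cconj z * Cconj w)%C.
Proof. unfold Cconj, Cmult; simpl; f_equal; ring. Qed.

Lemma Cconj_RtoC (x : R) : Cconj (RtoC x) = RtoC x.
Proof. unfold Cconj, RtoC; simpl; f_equal; ring. Qed.

Lemma Cconj_conj (z : C) : Cconj (Cconj z) = z.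
Proof. destruct z; unfold Cconj; simpl; f_equal; ring. Qed.

(** [contour_quadrant] for f and, conjugated, for its reflection: on the real axis
    the two kernels add up to theta' (P_r(theta) - 1), and on the imaginary axis
    they carry opposite signs, which produces the difference f(i t) - f(-i t). *)
Lemma contour_estimate (f : C -> C) (r T M1 M2 : R) (n : nat) :
  0 <= r < 1 -> p <= INR n -> 1 <= T ->
  (forall x y, 0 <= x -> cdiff f (x, y)) ->
  (forall x, 0 <= x <= INR n ->
     Cmod (f (x, T)) * exp (- 2 * PI * T) <= M1 /\
     Cmod (f (x, - T)) * exp (- 2 * PI * T) <= M1) ->
  RInt (fun y => exp (- 2 * PI * y) * Cmod (f (INR n, y))) 0 T <= M2 ->
  RInt (fun y => exp (- 2 * PI * y) * Cmod (f (INR n, - y))) 0 T <= M2 ->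
  Cmod (CInt (fun x => RtoC (dtheta p x * (poisson r (theta p x) - 1)) * f (x, 0))%C 0 (INR n)
        - RtoC (2 * PI) * Ci *
            CInt (fun t => RtoC (axis_kernel p r t) * (f (0, t) - f (0, (- t)%R)))%C 0 T)
  <= 2 * kernel_const p * (INR n * M1 + M2).
Proof.
  intros Hr Hn HT Hf HM1 HM2 HM3.
  assert (Hn0 : 0 <= INR n) by lra.
  assert (Hl : forall x y, 0 <= x -> cdiff (reflect f) (x, y)).
  { intros x y Hx. apply cdiff_conj. exact (Hf x (- y) Hx). }
  pose proof (contour_quadrant f r T M1 M2 n Hr Hn HT (fun x y Hx _ => Hf x y Hx)
    (fun x Hx => proj1 (HM1 x Hx)) HM2) as H1.
  assert (H2 : Cmod (CInt (fun x => reflect f (x, 0) * log_kernel p r (x, 0))%C 0 (INR n)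
        - Ci * CInt (fun y => reflect f (0, y) * log_kernel p r (0, y))%C 0 T)
    <= kernel_const p * (INR n * M1 + M2)).
  { apply contour_quadrant; auto.
    - intros x Hx. rewrite reflect_pair, Cmod_conj. apply (HM1 x Hx).
    - erewrite RInt_ext; [apply HM3|]. intros y _. simpl. rewrite reflect_pair, Cmod_conj. reflexivity. }
  assert (Hex : forall h, (forall x y, 0 <= x -> cdiff h (x, y)) ->
     ex_CInt (fun x => h (x, 0) * log_kernel p r (x, 0))%C 0 (INR n) /\
     ex_CInt (fun y => h (0, y) * log_kernel p r (0, y))%C 0 T).
  { intros h Hh. split; apply ex_CInt_ccont; try lra; intros x Hx.
    - apply (cdiff_line_x (fun z => h z * log_kernel p r z)%C).
      apply cdiff_mult; [apply Hh; lra|apply cdiff_log_kernel; lra].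
    - apply (cdiff_line_y (fun z => h z * log_kernel p r z)%C).
      apply cdiff_mult; [apply Hh; lra|apply cdiff_log_kernel; lra]. }
  destruct (Hex f Hf) as [E1 E2]. destruct (Hex _ Hl) as [E3 E4].
  set (A1 := CInt (fun x => f (x, 0) * log_kernel p r (x, 0))%C 0 (INR n)) in *.
  set (B1 := CInt (fun y => f (0, y) * log_kernel p r (0, y))%C 0 T) in *.
  set (A2 := CInt (fun x => reflect f (x, 0) * log_kernel p r (x, 0))%C 0 (INR n)) in *.
  set (B2 := CInt (fun y => reflect f (0, y) * log_kernel p r (0, y))%C 0 T) in *.
  assert (HI : (Ci * Ci = - (1))%C) by (unfold Ci, Cmult, Copp, RtoC; simpl; f_equal; ring).
  assert (EA : CInt (fun x => RtoC (dtheta p x * (poisson r (theta p x) - 1)) * f (x, 0))%C 0 (INR n)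
    = (- Ci * A1 + Cconj (- Ci * A2))%C).
  { unfold A1, A2. rewrite <- !CInt_scal, <- CInt_conj, <- CInt_plus; try assumption.
    - apply CInt_ext; [lra|]. intros x Hx. rewrite (log_kernel_real p Hp r x Hr).
      rewrite reflect_pair, Ropp_0, !Cconj_mult, Cconj_conj. ring.
    - apply ex_CInt_scal, E1.
    - apply ex_CInt_conj, ex_CInt_scal, E3.
    - apply ex_CInt_scal, E3. }
  assert (EB : (RtoC (2 * PI) * Ci * CInt (fun t => RtoC (axis_kernel p r t) * (f (0, t) - f (0, (- t)%R)))%C 0 T
    = B1 + Cconj B2)%C).
  { unfold B1, B2. rewrite <- CInt_conj by assumption.
    assert (E4' := ex_CInt_conj _ _ _ E4).
    rewrite <- CInt_plus by assumption.
    assert (EE : forall t, 0 <= t ->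
       (RtoC (axis_kernel p r t) * (f (0%R, t) - f (0%R, (- t)%R)) =
       (/ (RtoC (2 * PI) * Ci)) *
        (f (0%R, t) * log_kernel p r (0%R, t) + Cconj (reflect f (0%R, t) * log_kernel p r (0%R, t))))%C).
    { intros t Ht. rewrite log_kernel_imag by auto.
      rewrite reflect_pair, !Cconj_mult, Cconj_conj, Cconj_RtoC.
      replace (Cconj Ci) with (- Ci)%C by (unfold Cconj, Ci, Copp; simpl; f_equal; ring).
      rewrite (RtoC_mult (2 * PI)). pose proof PI_RGT_0. field. split.
      - intros K. inversion K; lra.
      - intros K. inversion K; lra. }
    rewrite (CInt_ext _ _ 0 T ltac:(lra) (fun t Ht => EE t ltac:(lra))).
    rewrite CInt_scal.
    - field. split.
      + intros K. inversion K; lra.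
      + pose proof PI_RGT_0. intros K. inversion K; lra.
    - apply ex_CInt_plus; assumption. }
  rewrite EA, EB.
  replace (- Ci * A1 + Cconj (- Ci * A2) - (B1 + Cconj B2))%C
    with (- Ci * (A1 - Ci * B1) + Cconj (- Ci * (A2 - Ci * B2)))%C.
  2: { replace (- Ci * (A1 - Ci * B1))%C with (- Ci * A1 + (Ci * Ci) * B1)%C by ring.
       replace (- Ci * (A2 - Ci * B2))%C with (- Ci * A2 + (Ci * Ci) * B2)%C by ring.
       rewrite HI.
       assert (Ec : forall z w, Cconj (z + w) = (Cconj z + Cconj w)%C)
         by (intros; unfold Cconj, Cplus; simpl; f_equal; ring).
       rewrite Ec, (Cconj_mult (- (1))).
       replace (Cconj (- (1))) with (- (1))%C by (unfold Cconj, Copp, RtoC; simpl; f_equal; ring).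
       ring. }
  eapply Rle_trans; [apply Cmod_triangle|].
  rewrite Cmod_conj, !Cmod_mult, Cmod_opp, Cmod_Ci, !Rmult_1_l. lra.
Qed.
End contour.

(** * Limits as the damping disappears, and concentrating kernels *)

(** Limits as the damping parameter r tends to 1 from below. *)
Definition tends_at_1 (phi : R -> R) (l : R) : Prop :=
  forall eps, 0 < eps -> at_left 1 (fun r => Rabs (phi r - l) < eps).

Definition ctends_at_1 (phi : R -> C) (l : C) : Prop :=
  forall eps, 0 < eps -> at_left 1 (fun r => Cmod (phi r - l) < eps).

Lemma at_left_unit : at_left 1 (fun r => 0 <= r < 1).
Proof.
  exists (mkposreal 1 Rlt_0_1). intros r Hr Hr1. split; [|exact Hr1].
  unfold ball in Hr; simpl in Hr. unfold AbsRing_ball, abs, minus, plus, opp in Hr; simpl in Hr.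
  apply Rabs_def2 in Hr. lra.
Qed.

Lemma at_left_and (P Q : R -> Prop) :
  at_left 1 P -> at_left 1 Q -> at_left 1 (fun r => P r /\ Q r).
Proof. apply filter_and. Qed.

Lemma at_left_imp (P Q : R -> Prop) :
  (forall r, P r -> Q r) -> at_left 1 P -> at_left 1 Q.
Proof. apply filter_imp. Qed.

Lemma ctends_plus (f g : R -> C) (l m : C) :
  ctends_at_1 f l -> ctends_at_1 g m -> ctends_at_1 (fun r => f r + g r)%C (l + m)%C.
Proof.
  intros Hf Hg eps He.
  eapply at_left_imp; [|apply (at_left_and _ _ (Hf (eps / 2) ltac:(lra)) (Hg (eps / 2) ltac:(lra)))].
  intros r [H1 H2]. simpl in *.
  replace (f r + g r - (l + m))%C with ((f r - l) + (g r - m))%C by ring.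
  eapply Rle_lt_trans; [apply Cmod_triangle|lra].
Qed.

Lemma ctends_ext (f g : R -> C) (l : C) :
  (forall r, 0 <= r < 1 -> f r = g r) -> ctends_at_1 f l -> ctends_at_1 g l.
Proof.
  intros H Hf eps He. eapply at_left_imp; [|apply (at_left_and _ _ at_left_unit (Hf eps He))].
  intros r [H1 H2]. rewrite <- H; auto.
Qed.

Lemma tends_of_continuous (phi : R -> R) : continuous phi 1 -> tends_at_1 phi (phi 1).
Proof.
  intros H eps He.
  destruct (proj1 (filterlim_locally _ _) H (mkposreal eps He)) as [d Hd].
  exists d. intros r Hr _. exact (Hd r Hr).
Qed.

Lemma tends_minus (f g : R -> R) (l m : R) :
  tends_at_1 f l -> tends_at_1 g m -> tends_at_1 (fun r => f r - g r) (l - m).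
Proof.
  intros Hf Hg eps He.
  eapply at_left_imp; [|apply (at_left_and _ _ (Hf (eps / 2) ltac:(lra)) (Hg (eps / 2) ltac:(lra)))].
  intros r [H1 H2]. apply Rabs_def2 in H1. apply Rabs_def2 in H2. apply Rabs_def1; lra.
Qed.

Lemma tends_const (l : R) : tends_at_1 (fun _ => l) l.
Proof.
  intros eps He. eapply at_left_imp; [|apply at_left_unit]. intros r _.
  rewrite Rminus_diag, Rabs_R0. exact He.
Qed.

Lemma ctends_norm_le (phi : R -> C) (l : C) (B : R) :
  (forall r, 0 <= r < 1 -> Cmod (phi r) <= B) -> ctends_at_1 phi l -> Cmod l <= B.
Proof.
  intros HB H. apply le_epsilon. intros eps He.
  destruct (filter_ex (F := at_left 1) _ (at_left_and _ _ at_left_unit (H eps He))) as [r [Hr1 Hr2]].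
  specialize (HB r Hr1).
  replace l with (phi r + - (phi r - l))%C by ring.
  eapply Rle_trans; [apply Cmod_triangle|]. rewrite Cmod_opp. lra.
Qed.

Lemma ctends_const (l : C) : ctends_at_1 (fun _ => l) l.
Proof.
  intros eps He. eapply at_left_imp; [|apply at_left_unit]. intros r _.
  replace (l - l)%C with (RtoC 0) by ring. rewrite Cmod_0. exact He.
Qed.

Lemma ctends_scal (k : C) (f : R -> C) (l : C) :
  ctends_at_1 f l -> ctends_at_1 (fun r => k * f r)%C (k * l)%C.
Proof.
  intros H eps He. pose proof (Cmod_ge_0 k) as Hk.
  assert (He' : 0 < eps / (Cmod k + 1)) by (apply Rdiv_lt_0_compat; lra).
  eapply at_left_imp; [|apply (H _ He')]. intros r Hr. simpl in Hr.
  replace (k * f r - k * l)%C with (k * (f r - l))%C by ring. rewrite Cmod_mult.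
  pose proof (Cmod_ge_0 (f r - l)).
  apply Rmult_lt_compat_r with (r := Cmod k + 1) in Hr; [|lra].
  replace (eps / (Cmod k + 1) * (Cmod k + 1)) with eps in Hr by (field; lra). nra.
Qed.

Lemma ccont_scal (k : R -> R) (g : R -> C) (x : R) :
  continuous k x -> ccont g x -> ccont (fun t => RtoC (k t) * g t)%C x.
Proof.
  intros Hk Hg.
  apply (continuous_ext (fun t => @scal R_AbsRing C_R_NormedModule (k t) (g t))).
  - intros t. destruct (g t) as [u v]. unfold RtoC, Cmult; simpl.
    unfold scal; simpl. unfold prod_scal, scal; simpl. unfold mult; simpl. f_equal; ring.
  - exact (@continuous_scal R_UniformSpace R_AbsRing C_R_NormedModule k g x Hk Hg).
Qed.

Lemma ccont_minus (f g : R -> C) (x : R) :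
  ccont f x -> ccont g x -> ccont (fun t => f t - g t)%C x.
Proof. exact (@continuous_minus R_UniformSpace R_AbsRing C_R_NormedModule f g x). Qed.

Lemma ccont_const (c : C) (x : R) : ccont (fun _ => c) x.
Proof. apply (@continuous_const R_UniformSpace C_UniformSpace). Qed.

Lemma ccont_elim (g : R -> C) (x : R) :
  ccont g x -> forall eps, 0 < eps -> exists del, 0 < del /\
    forall t, Rabs (t - x) < del -> Cmod (g t - g x) < eps.
Proof.
  intros H eps He.
  assert (H' : continuous (fun t => Cmod (g t - g x)) x)
    by (apply ccont_Cmod, ccont_minus; [exact H|apply ccont_const]).
  destruct (proj1 (filterlim_locally _ _) H' (mkposreal eps He)) as [d Hd].
  exists d. split; [apply cond_pos|]. intros t Ht. specialize (Hd t Ht).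
  replace (g x - g x)%C with (RtoC 0) in Hd by ring. rewrite Cmod_0 in Hd.
  unfold ball in Hd; simpl in Hd. unfold AbsRing_ball, abs, minus, plus, opp in Hd; simpl in Hd.
  apply Rabs_def2 in Hd. lra.
Qed.

Lemma ccont_bounded (g : R -> C) (a b : R) :
  a <= b -> (forall x, a <= x <= b -> ccont g x) ->
  exists M, 0 <= M /\ forall x, a <= x <= b -> Cmod (g x) <= M.
Proof.
  intros Hab H.
  destruct (continuity_ab_maj (fun x => Cmod (g x)) a b Hab) as [m [Hm _]].
  - intros x Hx. apply continuity_pt_filterlim. apply ccont_Cmod, H, Hx.
  - exists (Cmod (g m)). split; [apply Cmod_ge_0|exact Hm].
Qed.

(** A nonnegative kernel has mass A v - A u on [u, v] when A is a primitive of it. *)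
Lemma CInt_kernel_bound (A k : R -> R) (g : R -> C) (u v m : R) :
  u <= v -> (forall x, is_derive A x (k x)) -> (forall x, continuous k x) ->
  (forall x, 0 <= k x) -> (forall x, u <= x <= v -> ccont g x) ->
  (forall x, u <= x <= v -> Cmod (g x) <= m) ->
  Cmod (CInt (fun x => RtoC (k x) * g x)%C u v) <= m * (A v - A u).
Proof.
  intros Huv HA Hk Hk0 Hg Hm.
  assert (HI : is_RInt k u v (A v - A u)) by (apply (is_RInt_derive A k); auto).
  assert (HI' : is_RInt (fun x => m * k x) u v (m * (A v - A u)))
    by exact (is_RInt_scal (V := R_NormedModule) k u v m _ HI).
  rewrite <- (is_RInt_unique _ _ _ _ HI').
  apply CInt_norm_le; [exact Huv| |exists (m * (A v - A u)); exact HI'|].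
  - apply ex_CInt_ccont; [exact Huv|]. intros x Hx. apply ccont_scal; auto.
  - intros x Hx. rewrite Cmod_mult, Cmod_R, Rabs_pos_eq by auto.
    specialize (Hm x Hx). specialize (Hk0 x). rewrite Rmult_comm. apply Rmult_le_compat_r; auto.
Qed.

(** An approximate identity described through its primitives: if A r tends to a step
    function with a single jump J at c, the nonnegative kernels k r converge to J times
    the Dirac mass at c.  Working with primitives allows c to be an end point of
    [a, b], the jump then being the part of the mass that lies on one side. *)
Lemma kernel_concentration (A k : R -> R -> R) (g : R -> C) (a b c J : R) :
  a <= c <= b ->
  (forall x, a <= x <= b -> ccont g x) ->
  (forall r x, 0 <= r < 1 -> is_derive (A r) x (k r x)) ->
  (forall r x, 0 <= r < 1 -> continuous (k r) x) ->
  (forall r x, 0 <= r < 1 -> 0 <= k r x) ->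
  (forall x, a <= x < c -> tends_at_1 (fun r => A r x - A r a) 0) ->
  (forall x, c < x <= b -> tends_at_1 (fun r => A r b - A r x) 0) ->
  tends_at_1 (fun r => A r b - A r a) J ->
  ctends_at_1 (fun r => CInt (fun x => RtoC (k r x) * g x)%C a b) (RtoC J * g c)%C.
Proof.
  intros Hc Hg HA Hk Hk0 Hl Hr HJ eps He.
  destruct (ccont_bounded g a b ltac:(lra) Hg) as [M [HM0 HM]].
  (* K dominates the four factors 2 M, 2 M, J + 1 and |g c| that multiply eta below. *)
  set (K := 2 * M + Rabs J + 1 + Cmod (g c)).
  pose proof (Rabs_pos J) as HJ0. pose proof (Cmod_ge_0 (g c)) as Hgc0.
  assert (HK : 1 <= K) by (unfold K; lra).
  set (eta := eps / (8 * K)).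
  assert (Heta : 0 < eta) by (apply Rdiv_lt_0_compat; lra).
  assert (HetaK : 8 * (K * eta) = eps) by (unfold eta; field; lra).
  clearbody eta.
  destruct (ccont_elim g c (Hg c Hc) eta Heta) as [del [Hd Hdel]].
  (* Near c the oscillation of g is at most eta; outside [x1, x2] the mass is small. *)
  set (x1 := Rmax a (c - del / 2)). set (x2 := Rmin b (c + del / 2)).
  assert (Hx1 : a <= x1 <= c /\ c - del / 2 <= x1).
  { unfold x1. pose proof (Rmax_l a (c - del / 2)). pose proof (Rmax_r a (c - del / 2)).
    repeat split; try lra. apply Rmax_lub; lra. }
  assert (Hx2 : c <= x2 <= b /\ x2 <= c + del / 2).
  { unfold x2. pose proof (Rmin_l b (c + del / 2)). pose proof (Rmin_r b (c + del / 2)).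
    repeat split; try lra. apply Rmin_glb; lra. }
  assert (L1 : tends_at_1 (fun r => A r x1 - A r a) 0).
  { destruct (Rmax_case_strong a (c - del / 2) (fun z => z = a \/ z = c - del / 2)) as [E|E];
      auto; fold x1 in E; [|apply Hl; lra].
    rewrite E. intros e Hepos. eapply at_left_imp; [|apply at_left_unit]. intros r _.
    replace (A r a - A r a - 0) with 0 by ring. rewrite Rabs_R0. exact Hepos. }
  assert (L2 : tends_at_1 (fun r => A r b - A r x2) 0).
  { destruct (Rmin_case_strong b (c + del / 2) (fun z => z = b \/ z = c + del / 2)) as [E|E];
      auto; fold x2 in E; [|apply Hr; lra].
    rewrite E. intros e Hepos. eapply at_left_imp; [|apply at_left_unit]. intros r _.
    replace (A r b - A r b - 0) with 0 by ring. rewrite Rabs_R0. exact Hepos. }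
  eapply at_left_imp; [|apply (at_left_and _ _ at_left_unit (at_left_and _ _ (L1 eta Heta)
     (at_left_and _ _ (L2 eta Heta) (at_left_and _ _ (HJ eta Heta) (HJ 1 Rlt_0_1)))))].
  intros r (Hr1 & H1 & H2 & H3 & H4).
  apply Rabs_def2 in H1. apply Rabs_def2 in H2. apply Rabs_def2 in H4.
  set (D := fun x => (g x - g c)%C).
  assert (HDc : forall x, a <= x <= b -> ccont D x)
    by (intros x Hx; apply ccont_minus; [auto|apply ccont_const]).
  assert (HkD : forall u v, a <= u -> u <= v -> v <= b -> ex_CInt (fun x => RtoC (k r x) * D x)%C u v).
  { intros u v Hu Huv Hv. apply ex_CInt_ccont; [lra|]. intros x Hx. apply ccont_scal; [auto|].
    apply HDc; lra. }
  assert (Hfar : forall x, a <= x <= b -> Cmod (D x) <= 2 * M).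
  { intros x Hx. unfold D, Cminus. eapply Rle_trans; [apply Cmod_triangle|]. rewrite Cmod_opp.
    pose proof (HM x Hx). pose proof (HM c Hc). lra. }
  assert (Hmass : is_RInt (k r) a b (A r b - A r a)) by (apply (is_RInt_derive (A r) (k r)); auto).
  assert (HkI : CInt (fun x => RtoC (k r x) * g c)%C a b = (RtoC (A r b - A r a) * g c)%C).
  { apply CInt_unique. rewrite Cmult_comm.
    eapply is_RInt_ext; [intros x _; apply Cmult_comm|].
    apply is_CInt_scal. apply is_CInt_pair. split; [exact Hmass|].
    simpl. pose proof (is_RInt_const (V := R_NormedModule) a b 0) as H0.
    unfold scal in H0; simpl in H0. unfold mult in H0; simpl in H0. rewrite Rmult_0_r in H0. exact H0. }
  assert (Esplit : CInt (fun x => RtoC (k r x) * g x)%C a b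
    = (CInt (fun x => RtoC (k r x) * D x) a x1 + CInt (fun x => RtoC (k r x) * D x) x1 x2
       + CInt (fun x => RtoC (k r x) * D x) x2 b + RtoC (A r b - A r a) * g c)%C).
  { rewrite (CInt_Chasles _ a x1 x2), (CInt_Chasles _ a x2 b) by (apply HkD; lra).
    rewrite <- HkI, <- CInt_plus.
    - apply CInt_ext; [lra|]. intros x Hx. unfold D. ring.
    - apply HkD; lra.
    - apply ex_CInt_ccont; [lra|]. intros x Hx. apply ccont_scal; [auto|apply ccont_const]. }
  rewrite Esplit.
  match goal with |- Cmod (?u + ?v + ?w + RtoC ?m * _ - _) < _ =>
    replace (u + v + w + RtoC m * g c - RtoC J * g c)%C
      with (u + v + w + RtoC (m - J) * g c)%C by (rewrite RtoC_minus; ring) end.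
  assert (B1 : Cmod (CInt (fun x => RtoC (k r x) * D x)%C a x1) <= 2 * M * (A r x1 - A r a)).
  { apply CInt_kernel_bound; auto; try lra; intros x Hx; [apply HDc|apply Hfar]; lra. }
  assert (B3 : Cmod (CInt (fun x => RtoC (k r x) * D x)%C x2 b) <= 2 * M * (A r b - A r x2)).
  { apply CInt_kernel_bound; auto; try lra; intros x Hx; [apply HDc|apply Hfar]; lra. }
  assert (B2 : Cmod (CInt (fun x => RtoC (k r x) * D x)%C x1 x2) <= eta * (A r x2 - A r x1)).
  { apply CInt_kernel_bound; auto; try lra; intros x Hx; [apply HDc; lra|].
    apply Rlt_le, Hdel. apply Rabs_def1; lra. }
  eapply Rle_lt_trans; [apply Cmod_triangle|].
  eapply Rle_lt_trans; [apply Rplus_le_compat_r, Cmod_triangle|].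
  eapply Rle_lt_trans; [apply Rplus_le_compat_r, Rplus_le_compat_r, Cmod_triangle|].
  rewrite Cmod_mult, Cmod_R.
  assert (Hmono : forall u v, u <= v -> 0 <= A r v - A r u).
  { intros u v Huv. apply (is_RInt_le (fun _ => 0) (k r) u v 0); [exact Huv| | |intros; apply Hk0; lra].
    - pose proof (is_RInt_const (V := R_NormedModule) u v 0) as H0.
      unfold scal in H0; simpl in H0. unfold mult in H0; simpl in H0. rewrite Rmult_0_r in H0. exact H0.
    - apply (is_RInt_derive (A r) (k r)); auto. }
  pose proof (Hmono a x1 ltac:(lra)). pose proof (Hmono x1 x2 ltac:(lra)).
  pose proof (Hmono x2 b ltac:(lra)).
  pose proof (Rle_abs J).
  assert (2 * M * (A r x1 - A r a) <= K * eta).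
  { apply Rmult_le_compat; unfold K; lra. }
  assert (2 * M * (A r b - A r x2) <= K * eta).
  { apply Rmult_le_compat; unfold K; lra. }
  assert (eta * (A r x2 - A r x1) <= K * eta).
  { rewrite Rmult_comm. apply Rmult_le_compat; unfold K; lra. }
  assert (Rabs (A r b - A r a - J) * Cmod (g c) <= K * eta).
  { rewrite Rmult_comm. apply Rmult_le_compat; try apply Rabs_pos; unfold K; lra. }
  assert (0 < K * eta) by (apply Rmult_lt_0_compat; lra). lra.
Qed.

(** * The Poisson kernel of the phase selects the roots *)

(** theta - 2 Im log(1 - r e^{i theta}); the logarithm is taken on the right half
    plane, so that this primitive is smooth on the whole line, unlike the usual one
    through tan(theta / 2). *)
Definition poisson_primitive (r th : R) : R :=
  th + 2 * atan (r * sin th / (1 - r * cos th)).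

Lemma poisson_primitive_den (r th : R) : 0 <= r < 1 -> 0 < 1 - r * cos th.
Proof. intros Hr. pose proof (COS_bound th). nra. Qed.

Lemma poisson_primitive_derive (r th : R) :
  0 <= r < 1 -> is_derive (poisson_primitive r) th (poisson r th).
Proof.
  intros Hr. pose proof (poisson_primitive_den r th Hr) as Hd. pose proof (poisson_den_pos r th Hr) as Hd2.
  unfold poisson_primitive, poisson. auto_derive; [lra|].
  pose proof (sin2_cos2 th) as Hsc. unfold Rsqr in Hsc.
  set (c := cos th) in *. set (s := sin th) in *.
  assert (HD : (1 - r * c) ^ 2 + (r * s) ^ 2 = 1 - 2 * r * c + r ^ 2).
  { transitivity (1 - 2 * r * c + r ^ 2 * (s * s + c * c)); [ring|rewrite Hsc; ring]. }
  replace (1 + (r * s / (1 - r * c))²) with ((1 - 2 * r * c + r ^ 2) / (1 - r * c) ^ 2)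
    by (rewrite <- HD; unfold Rsqr; field; lra).
  assert (Hs2 : s ^ 2 = 1 - c ^ 2) by (rewrite <- Hsc; ring).
  field_simplify_eq; [|split; lra].
  ring_simplify. rewrite ?Hs2. ring.
Qed.

Section phase.
Variables (p : R) (Hp : 0 < p).

Lemma theta_derive (x : R) : is_derive (theta p) x (dtheta p x).
Proof.
  unfold theta, dtheta. auto_derive; [exact I|]. unfold Rsqr. field. split; nra.
Qed.

Lemma dtheta_pos (x : R) : 0 < dtheta p x.
Proof.
  unfold dtheta. pose proof PI_RGT_0.
  assert (0 < 2 * p / (p ^ 2 + x ^ 2)) by (apply Rdiv_lt_0_compat; nra). lra.
Qed.

Lemma theta_increasing (x y : R) : x < y -> theta p x < theta p y.
Proof.
  intros H. unfold theta. pose proof PI_RGT_0.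
  assert (x / p < y / p) by (apply Rmult_lt_compat_r; [apply Rinv_0_lt_compat|]; lra).
  pose proof (atan_increasing _ _ H1). nra.
Qed.

Lemma theta_0 : theta p 0 = 0.
Proof. unfold theta. unfold Rdiv. rewrite Rmult_0_l, atan_0. ring. Qed.

Lemma theta_bounds (x : R) : 0 < x -> 2 * PI * x < theta p x < 2 * PI * x + PI.
Proof.
  intros Hx. unfold theta.
  assert (0 < x / p) by (apply Rdiv_lt_0_compat; lra).
  pose proof (atan_increasing _ _ H). rewrite atan_0 in H0.
  pose proof (atan_bound (x / p)). lra.
Qed.

Lemma tan_plus_nPI (x : R) (n : nat) : tan (x + INR n * PI) = tan x.
Proof.
  induction n as [|n IH]; [simpl; f_equal; ring|].
  rewrite <- IH, S_INR. unfold tan.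
  replace (x + (INR n + 1) * PI) with (x + INR n * PI + PI) by ring.
  rewrite neg_sin, neg_cos. set (u := sin _). set (v := cos _).
  unfold Rdiv. rewrite Rinv_opp. ring.
Qed.

(** The interval (n - 1/2, n) selects the branch: pi n - pi x lies in (0, pi / 2) and
    has tangent x / p, so it is atan(x / p). *)
Lemma theta_root (x : R) (n : nat) :
  INR n - 1 / 2 < x < INR n -> tan (PI * x) = - x / p -> theta p x = 2 * PI * INR n.
Proof.
  intros Hx Ht. pose proof PI_RGT_0.
  assert (E : atan (x / p) = INR n * PI - PI * x).
  { rewrite <- (atan_tan (INR n * PI - PI * x)) by (split; nra). f_equal.
    replace (INR n * PI - PI * x) with (- (PI * x) + INR n * PI) by ring.
    rewrite tan_plus_nPI, tan_neg, Ht. field. lra. }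
  unfold theta. rewrite E. ring.
Qed.

Lemma cos_lt_1 (th : R) (k : nat) :
  2 * PI * INR k < th < 2 * PI * INR k + 2 * PI -> cos th < 1.
Proof.
  intros H. replace th with (2 * ((th - 2 * INR k * PI) / 2) + 2 * INR k * PI) by field.
  rewrite cos_period, cos_2a_sin.
  assert (0 < sin ((th - 2 * INR k * PI) / 2)) by (apply sin_gt_0; lra). nra.
Qed.

(** With phi = theta / 2 modulo pi, sin theta / (1 - cos theta) is cot phi, and
    atan (cot phi) = pi / 2 - phi for 0 < phi < pi.  The limit is a step function
    with jumps 2 pi at the multiples of 2 pi. *)
Lemma poisson_primitive_limit (th : R) (k : nat) :
  2 * PI * INR k < th < 2 * PI * INR k + 2 * PI ->
  tends_at_1 (fun r => poisson_primitive r th) (2 * PI * INR k + PI).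
Proof.
  intros H. pose proof (cos_lt_1 th k H) as Hc.
  replace (2 * PI * INR k + PI) with (poisson_primitive 1 th).
  - apply (tends_of_continuous (fun r => poisson_primitive r th)).
    apply (ex_derive_continuous (fun r => poisson_primitive r th)). unfold poisson_primitive. auto_derive. lra.
  - unfold poisson_primitive. set (ph := (th - 2 * INR k * PI) / 2).
    assert (E : th = 2 * ph + 2 * INR k * PI) by (unfold ph; field).
    assert (Hph : 0 < ph < PI) by (unfold ph; lra).
    assert (Hs : 0 < sin ph) by (apply sin_gt_0; lra).
    assert (Ht : 1 * sin th / (1 - 1 * cos th) = tan (PI / 2 - ph)).
    { rewrite E, sin_period, cos_period, sin_2a, cos_2a_sin.
      unfold tan. rewrite sin_shift, cos_shift. field. split; nra. }
    rewrite Ht, atan_tan by lra. lra.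
Qed.

Lemma poisson_primitive_0 (r : R) : poisson_primitive r 0 = 0.
Proof. unfold poisson_primitive. rewrite sin_0, Rmult_0_r. unfold Rdiv. rewrite Rmult_0_l, atan_0. ring. Qed.

Definition phase_poisson (r x : R) : R := dtheta p x * poisson r (theta p x).

Lemma phase_poisson_derive (r x : R) : 0 <= r < 1 ->
  is_derive (fun x => poisson_primitive r (theta p x)) x (phase_poisson r x).
Proof.
  intros Hr. apply (is_derive_comp (poisson_primitive r) (theta p));
    [apply poisson_primitive_derive, Hr|apply theta_derive].
Qed.

Lemma phase_poisson_continuous (r x : R) : 0 <= r < 1 -> continuous (phase_poisson r) x.
Proof.
  intros Hr. apply (ex_derive_continuous (phase_poisson r)). pose proof (poisson_den_pos r (theta p x) Hr) as H.
  unfold phase_poisson, dtheta, poisson, theta in *. auto_derive.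
  unfold Rminus in H. repeat split; try nra.
Qed.

Lemma phase_poisson_ge0 (r x : R) : 0 <= r < 1 -> 0 <= phase_poisson r x.
Proof.
  intros Hr. apply Rmult_le_pos; [apply Rlt_le, dtheta_pos|].
  apply Rlt_le, Rdiv_lt_0_compat; [nra|apply poisson_den_pos, Hr].
Qed.

Variable g : R -> C.
Hypothesis Hg : forall x, 0 <= x -> ccont g x.

Lemma phase_poisson_at_root (a b c : R) (m : nat) :
  0 <= a -> a < c < b -> theta p c = 2 * PI * INR (S m) ->
  2 * PI * INR m < theta p a -> theta p b < 2 * PI * INR (S m) + 2 * PI ->
  ctends_at_1 (fun r => CInt (fun x => RtoC (phase_poisson r x) * g x)%C a b) (RtoC (2 * PI) * g c)%C.
Proof.
  intros Ha Hc Hth Hta Htb.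
  assert (HS : 2 * PI * INR (S m) = 2 * PI * INR m + 2 * PI) by (rewrite S_INR; ring).
  assert (Low : forall x, a <= x < c -> tends_at_1 (fun r => poisson_primitive r (theta p x)) (2 * PI * INR m + PI)).
  { intros x Hx. apply poisson_primitive_limit. rewrite <- HS, <- Hth. split; [|apply theta_increasing; lra].
    destruct (Req_dec x a) as [->|]; [exact Hta|].
    pose proof (theta_increasing a x ltac:(lra)). lra. }
  assert (High : forall x, c < x <= b -> tends_at_1 (fun r => poisson_primitive r (theta p x)) (2 * PI * INR (S m) + PI)).
  { intros x Hx. apply poisson_primitive_limit. rewrite <- Hth at 1. split; [apply theta_increasing; lra|].
    destruct (Req_dec x b) as [->|]; [exact Htb|].
    pose proof (theta_increasing x b ltac:(lra)). lra. }
  apply (kernel_concentration (fun r x => poisson_primitive r (theta p x)) phase_poisson); try lra.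
  - intros x Hx. apply Hg. lra.
  - intros; apply phase_poisson_derive; auto.
  - intros; apply phase_poisson_continuous; auto.
  - intros; apply phase_poisson_ge0; auto.
  - intros x Hx. rewrite <- (Rminus_diag (2 * PI * INR m + PI)).
    apply tends_minus; apply Low; lra.
  - intros x Hx. rewrite <- (Rminus_diag (2 * PI * INR (S m) + PI)).
    apply tends_minus; apply High; lra.
  - replace (2 * PI) with ((2 * PI * INR (S m) + PI) - (2 * PI * INR m + PI)) by lra.
    apply tends_minus; [apply High|apply Low]; lra.
Qed.

(** The primitive vanishes at 0 for every r and tends to pi just to the right of 0:
    half of the jump at 0 belongs to this side. *)
Lemma phase_poisson_at_0 (b : R) :
  0 < b -> theta p b < 2 * PI ->
  ctends_at_1 (fun r => CInt (fun x => RtoC (phase_poisson r x) * g x)%C 0 b) (RtoC PI * g 0)%C.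
Proof.
  intros Hb Htb.
  assert (High : forall x, 0 < x <= b -> tends_at_1 (fun r => poisson_primitive r (theta p x)) PI).
  { intros x Hx. replace PI with (2 * PI * INR 0 + PI) by (simpl; ring). apply poisson_primitive_limit.
    simpl INR. pose proof (theta_increasing 0 x ltac:(lra)) as H0. rewrite theta_0 in H0.
    destruct (Req_dec x b) as [->|]; [lra|].
    pose proof (theta_increasing x b ltac:(lra)). lra. }
  apply (kernel_concentration (fun r x => poisson_primitive r (theta p x)) phase_poisson); try lra.
  - intros x Hx. apply Hg. lra.
  - intros; apply phase_poisson_derive; auto.
  - intros; apply phase_poisson_continuous; auto.
  - intros; apply phase_poisson_ge0; auto.
  - intros x Hx. exfalso. lra.
  - intros x Hx. rewrite <- (Rminus_diag PI). apply tends_minus; apply High; lra.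
  - replace PI with (PI - 0) at 1 by ring.
    apply (tends_minus (fun r => poisson_primitive r (theta p b)) (fun r => poisson_primitive r (theta p 0)) PI 0);
      [apply High; lra|].
    intros eps He. eapply at_left_imp; [|apply (tends_const 0 eps He)].
    intros r. rewrite theta_0, poisson_primitive_0. auto.
Qed.

(** Induction over [n, n + 1], each of which contains one root in its interior.  The
    first unit interval is cut at 1/2, which separates 0 from lambda_1. *)
Lemma phase_poisson_limit (lam : nat -> R) :
  (forall n : nat, (1 <= n)%nat ->
       INR n - 1 / 2 < lam n < INR n /\ tan (PI * lam n) = - lam n / p) ->
  forall N : nat,
  ctends_at_1 (fun r => CInt (fun x => RtoC (phase_poisson r x) * g x)%C 0 (INR (S N)))
    (RtoC (2 * PI) * (RtoC (1 / 2) * g 0 + sum_n (G := C_AbelianMonoid) (fun n => g (lam (S n))) N))%C.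
Proof.
  intros Hlam. pose proof PI_RGT_0 as Hpi.
  assert (Hex : forall r u v, 0 <= r < 1 -> 0 <= u <= v -> ex_CInt (fun x => RtoC (phase_poisson r x) * g x)%C u v).
  { intros r u v Hr Hu. apply ex_CInt_ccont; [lra|]. intros x Hx.
    apply ccont_scal; [apply phase_poisson_continuous, Hr|apply Hg; lra]. }
  induction N as [|N IH].
  - destruct (Hlam 1%nat (le_n 1)) as [Hx Ht]. pose proof (theta_root _ _ Hx Ht) as Hth.
    simpl INR in *.
    pose proof (theta_bounds (1 / 2) ltac:(lra)) as Hb. pose proof (theta_bounds 1 ltac:(lra)) as Hb1.
    apply (ctends_ext (fun r => CInt (fun x => RtoC (phase_poisson r x) * g x) 0 (1 / 2)
            + CInt (fun x => RtoC (phase_poisson r x) * g x) (1 / 2) 1)%C).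
    { intros r Hr. apply CInt_Chasles; apply Hex; auto; lra. }
    rewrite sum_O.
    replace (RtoC (2 * PI) * (RtoC (1 / 2) * g 0%R + g (lam 1%nat)))%C
      with (RtoC PI * g 0%R + RtoC (2 * PI) * g (lam 1%nat))%C.
    2: { replace (RtoC PI) with (RtoC (2 * PI) * RtoC (1 / 2))%C
           by (rewrite <- RtoC_mult; f_equal; field). ring. }
    apply ctends_plus.
    + apply phase_poisson_at_0; lra.
    + apply (phase_poisson_at_root (1 / 2) 1 (lam 1%nat) 0); simpl INR; lra.
  - destruct (Hlam (S (S N)) ltac:(lia)) as [Hx Ht]. pose proof (theta_root _ _ Hx Ht) as Hth.
    assert (HSN : INR (S (S N)) = INR (S N) + 1) by (rewrite S_INR; reflexivity).
    assert (H1 : 1 <= INR (S N)) by (rewrite S_INR; pose proof (pos_INR N); lra).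
    apply (ctends_ext (fun r => CInt (fun x => RtoC (phase_poisson r x) * g x) 0 (INR (S N))
            + CInt (fun x => RtoC (phase_poisson r x) * g x) (INR (S N)) (INR (S (S N))))%C).
    { intros r Hr. apply CInt_Chasles; apply Hex; auto; lra. }
    rewrite sum_Sn.
    match goal with |- ctends_at_1 _ (?k * (?u + plus ?v ?w))%C =>
      replace (k * (u + plus v w))%C with (k * (u + v) + k * w)%C end.
    2: { change plus with Cplus. ring. }
    apply ctends_plus; [exact IH|].
    apply (phase_poisson_at_root (INR (S N)) (INR (S (S N))) (lam (S (S N))) (S N)); try lra.
    + apply theta_bounds; lra.
    + pose proof (theta_bounds (INR (S (S N))) ltac:(lra)). lra.
Qed.
End phase.

(** * The limit of the integral on the imaginary axis *)

Section side.
Variables (p : R) (Hp : 0 < p).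

Lemma exp_neg_le1 (t : R) : 0 <= t -> exp (- 2 * PI * t) <= 1.
Proof.
  intros Ht. pose proof PI_RGT_0. rewrite <- exp_0.
  destruct (Req_dec t 0) as [->|]; [right; f_equal; ring|left; apply exp_increasing; nra].
Qed.

Lemma ratio_bound (t : R) : 0 <= t -> -1 <= (p - t) / (p + t) <= 1.
Proof.
  intros Ht. split; (apply Rmult_le_reg_r with (p + t); [lra|]);
    unfold Rdiv; rewrite Rmult_assoc, Rinv_l by lra; lra.
Qed.

(** From w(i t) <= e^{-2 pi t} <= 1 / (1 + 2 pi t); for t near 0 this is the linear
    lower bound, uniform in r, that controls the singularity of the kernel. *)
Lemma axis_den_ge (r t : R) : 0 <= r <= 1 -> 0 <= t ->
  2 * PI * t / (1 + 2 * PI * t) <= 1 - r * axis_phase p t.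
Proof.
  intros Hr Ht. pose proof PI_RGT_0 as Hpi. pose proof (ratio_bound t Ht) as Hq.
  assert (H0 : 0 <= 2 * PI * t) by nra.
  set (e := exp (- 2 * PI * t)). assert (He : 0 < e) by apply exp_pos.
  assert (He2 : e <= 1 / (1 + 2 * PI * t)).
  { unfold e. replace (- 2 * PI * t) with (- (2 * PI * t)) by ring. rewrite exp_Ropp.
    unfold Rdiv. rewrite Rmult_1_l. apply Rinv_le_contravar; [lra|].
    destruct (Req_dec (2 * PI * t) 0) as [->|]; [rewrite exp_0; lra|].
    apply Rlt_le, exp_ineq1. lra. }
  assert (r * axis_phase p t <= e).
  { unfold axis_phase. fold e. set (q := (p - t) / (p + t)) in *.
    assert (e * q <= e) by nra.
    destruct (Rle_dec 0 (e * q)); nra. }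
  replace (2 * PI * t / (1 + 2 * PI * t)) with (1 - 1 / (1 + 2 * PI * t)) by (field; lra).
  lra.
Qed.

Lemma axis_rate_bound (t : R) : 0 <= t -> Rabs (axis_rate p t) <= 2 * PI + 2 / p.
Proof.
  intros Ht. pose proof PI_RGT_0 as Hpi. pose proof (ratio_bound t Ht) as Hq.
  unfold axis_rate. rewrite Rabs_mult, Rabs_pos_eq by (apply Rlt_le, exp_pos).
  pose proof (exp_neg_le1 t Ht). pose proof (exp_pos (- 2 * PI * t)).
  assert (H2 : 0 <= 2 * p / (p + t) ^ 2 <= 2 / p).
  { assert (H3 : 0 < (p + t) ^ 2) by (apply pow_lt; lra).
    split; [apply Rlt_le, Rdiv_lt_0_compat; lra|].
    apply Rmult_le_reg_r with (p * (p + t) ^ 2); [apply Rmult_lt_0_compat; lra|].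
    replace (2 * p / (p + t) ^ 2 * (p * (p + t) ^ 2)) with (2 * p * p) by (field; lra).
    replace (2 / p * (p * (p + t) ^ 2)) with (2 * (p + t) ^ 2) by (field; lra). nra. }
  set (q := (p - t) / (p + t)) in *. set (s := 2 * p / (p + t) ^ 2) in *.
  assert (H3 : Rabs (2 * PI * q + s) <= 2 * PI + 2 / p) by (apply Rabs_le; split; nra).
  pose proof (Rabs_pos (2 * PI * q + s)). nra.
Qed.

Lemma axis_phase_0 : axis_phase p 0 = 1.
Proof. unfold axis_phase. rewrite Rmult_0_r, exp_0. field. lra. Qed.

Lemma axis_rate_0_pos : 0 < axis_rate p 0.
Proof.
  unfold axis_rate. rewrite Rmult_0_r, exp_0. pose proof PI_RGT_0.
  replace (2 * PI * ((p - 0) / (p + 0)) + 2 * p / (p + 0) ^ 2) with (2 * PI + 2 / p) by (field; lra).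
  assert (0 < 2 / p) by (apply Rdiv_lt_0_compat; lra). lra.
Qed.

Lemma axis_phase_derive (t : R) : p + t <> 0 -> is_derive (axis_phase p) t (- axis_rate p t).
Proof.
  intros H. unfold axis_phase, axis_rate. auto_derive; [exact H|]. field. exact H.
Qed.

Lemma axis_den_pos (r t : R) : 0 <= r <= 1 -> 0 < t -> 0 < 1 - r * axis_phase p t.
Proof.
  intros Hr Ht. eapply Rlt_le_trans; [|apply axis_den_ge; lra].
  pose proof PI_RGT_0. apply Rdiv_lt_0_compat; nra.
Qed.

Lemma axis_kernel_continuous (r t : R) :
  0 <= t -> 0 < 1 - r * axis_phase p t -> continuous (axis_kernel p r) t.
Proof.
  intros Ht Hd. apply (ex_derive_continuous (axis_kernel p r)). pose proof PI_RGT_0.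
  unfold axis_kernel, axis_rate, axis_phase in *. auto_derive.
  repeat split; try lra; try nra.
Qed.

Variable D : R -> C.
Hypothesis HDc : forall t, ccont D t.
Variable dD : C.
Hypothesis HD0 : forall eps, 0 < eps -> exists del, 0 < del /\
  forall t, Rabs t < del -> Cmod (D t - RtoC t * dD) <= eps * Rabs t.

(** The kernel at r = 1 behaves like a multiple of 1 / t at 0, and D vanishes there to
    first order.  Dividing both D and 1 - w(i t) by t, and completing the quotients at 0
    by the derivatives, gives the continuous extension [axis_integrand] of their
    product. *)
Definition jump_quotient (t : R) : C := if Req_EM_T t 0 then dD else (D t / RtoC t)%C.
Definition phase_quotient (t : R) : R :=
  if Req_EM_T t 0 then axis_rate p 0 else (1 - axis_phase p t) / t.
Definition axis_integrand (t : R) : C :=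
  (RtoC (axis_rate p t / (2 * PI) * / phase_quotient t) * jump_quotient t)%C.

Lemma axis_integrand_eq (t : R) :
  0 < t -> axis_integrand t = (RtoC (axis_kernel p 1 t) * D t)%C.
Proof.
  intros Ht. unfold axis_integrand, jump_quotient, phase_quotient.
  destruct (Req_EM_T t 0) as [|n]; [lra|].
  pose proof (axis_den_pos 1 t ltac:(lra) Ht) as Hw. rewrite Rmult_1_l in Hw. pose proof PI_RGT_0.
  unfold axis_kernel. rewrite !Rmult_1_l.
  replace (axis_rate p t / (2 * PI) * / ((1 - axis_phase p t) / t))
    with (t * (axis_rate p t / (2 * PI * (1 - axis_phase p t))))
    by (field; lra).
  rewrite RtoC_mult. field. intros K. inversion K; lra.
Qed.

Lemma phase_quotient_cont_0 : continuous phase_quotient 0.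
Proof.
  apply filterlim_locally. intros eps.
  destruct (real_derive_eps (axis_phase p) (- axis_rate p 0) (axis_phase_derive 0 ltac:(lra)) (eps / 2)
    ltac:(pose proof (cond_pos eps); lra)) as [d [Hd H]].
  exists (mkposreal d Hd). intros t Ht.
  unfold ball in *; simpl in *. unfold AbsRing_ball, abs, minus, plus, opp in *; simpl in *.
  rewrite Ropp_0, Rplus_0_r in Ht. specialize (H t Ht). unfold phase_quotient.
  destruct (Req_EM_T 0 0) as [_|]; [|lra]. pose proof (cond_pos eps).
  destruct (Req_EM_T t 0) as [->|n]; [rewrite Rplus_opp_r, Rabs_R0; lra|].
  rewrite axis_phase_0 in H. assert (0 < Rabs t) by (apply Rabs_pos_lt, n).
  replace ((1 - axis_phase p t) / t + - axis_rate p 0)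
    with (- ((axis_phase p t - 1 - t * - axis_rate p 0) / t)) by (field; auto).
  rewrite Rabs_Ropp, Rabs_div by auto.
  apply Rmult_lt_reg_r with (Rabs t); [lra|].
  unfold Rdiv. rewrite Rmult_assoc, Rinv_l by lra. nra.
Qed.

Lemma jump_quotient_cont_0 : ccont jump_quotient 0.
Proof.
  apply ccont_eps. intros eps He. destruct (HD0 (eps / 2) ltac:(lra)) as [d [Hd H]].
  exists d. split; [exact Hd|]. intros t Ht. rewrite Rminus_0_r in Ht. specialize (H t Ht).
  unfold jump_quotient. destruct (Req_EM_T 0 0) as [_|]; [|lra].
  destruct (Req_EM_T t 0) as [->|n].
  - replace (dD - dD)%C with (RtoC 0) by ring. rewrite Cmod_0. exact He.
  - assert (Hn : RtoC t <> 0%C) by (intros K; inversion K; auto).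
    assert (0 < Rabs t) by (apply Rabs_pos_lt, n).
    replace (D t / RtoC t - dD)%C with ((D t - RtoC t * dD) / RtoC t)%C by (field; auto).
    rewrite Cmod_div, Cmod_R by auto.
    apply Rmult_lt_reg_r with (Rabs t); [lra|].
    unfold Rdiv. rewrite Rmult_assoc, Rinv_l by lra. nra.
Qed.

Lemma axis_rate_continuous (t : R) : 0 <= t -> continuous (axis_rate p) t.
Proof.
  intros Ht. apply (ex_derive_continuous (axis_rate p)). unfold axis_rate. auto_derive.
  repeat split; try lra; try nra.
Qed.

Lemma axis_integrand_cont (t : R) : 0 <= t -> ccont axis_integrand t.
Proof.
  intros Ht. destruct (Req_dec t 0) as [->|n].
  - unfold axis_integrand. apply ccont_scal; [|apply jump_quotient_cont_0].
    apply (continuous_mult (K := R_AbsRing)).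
    + apply (continuous_mult (K := R_AbsRing)); [apply axis_rate_continuous; lra|apply continuous_const].
    + apply continuous_comp; [apply phase_quotient_cont_0|]. apply continuous_Rinv.
      unfold phase_quotient. destruct (Req_EM_T 0 0) as [_|]; [|lra]. pose proof axis_rate_0_pos. lra.
  - apply (@continuous_ext_loc R_UniformSpace C_UniformSpace axis_integrand (fun t => (RtoC (axis_kernel p 1 t) * D t)%C)).
    + exists (mkposreal t ltac:(lra)). intros s Hs. symmetry. apply axis_integrand_eq.
      unfold ball in Hs; simpl in Hs. unfold AbsRing_ball, abs, minus, plus, opp in Hs; simpl in Hs.
      apply Rabs_def2 in Hs. lra.
    + apply ccont_scal; [|apply HDc]. apply axis_kernel_continuous; [lra|apply axis_den_pos; lra].
Qed.

Lemma axis_kernel_bound (r t mu : R) : 0 <= r <= 1 -> 0 < t -> 0 < mu ->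
  mu * t <= 2 * PI * t / (1 + 2 * PI * t) ->
  Rabs (axis_kernel p r t) <= (2 * PI + 2 / p) / (mu * t).
Proof.
  intros Hr Ht Hmu Hm. pose proof (axis_den_ge r t Hr ltac:(lra)) as Hd.
  pose proof (axis_rate_bound t ltac:(lra)) as HV. pose proof PI2_1 as Hpi.
  set (c1 := 2 * PI + 2 / p) in *.
  assert (Hmt : 0 < mu * t) by nra.
  assert (Hc1 : 0 <= c1) by (eapply Rle_trans; [apply Rabs_pos|apply HV]).
  unfold axis_kernel. set (w := 1 - r * axis_phase p t) in *.
  rewrite Rabs_div by nra. rewrite Rabs_mult, (Rabs_pos_eq r), (Rabs_pos_eq (2 * PI * w)) by nra.
  apply Rmult_le_compat; [apply Rmult_le_pos; [lra|apply Rabs_pos]|apply Rlt_le, Rinv_0_lt_compat; nra| |].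
  - pose proof (Rabs_pos (axis_rate p t)). nra.
  - apply Rinv_le_contravar; nra.
Qed.

Lemma axis_kernel_diff_bound (r t mu : R) : 0 <= r <= 1 -> 0 < t -> 0 < mu ->
  mu * t <= 2 * PI * t / (1 + 2 * PI * t) ->
  Rabs (axis_kernel p r t - axis_kernel p 1 t) <= (1 - r) * ((2 * PI + 2 / p) / (mu * t) ^ 2).
Proof.
  intros Hr Ht Hmu Hm. pose proof (axis_den_ge r t Hr ltac:(lra)) as Hd.
  pose proof (axis_den_ge 1 t ltac:(lra) ltac:(lra)) as Hd1.
  pose proof (axis_rate_bound t ltac:(lra)) as HV. pose proof PI2_1 as Hpi.
  set (c1 := 2 * PI + 2 / p) in *.
  assert (Hmt : 0 < mu * t) by nra.
  assert (Hc1 : 0 <= c1) by (eapply Rle_trans; [apply Rabs_pos|apply HV]).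
  unfold axis_kernel. rewrite !Rmult_1_l in *.
  replace (r * axis_rate p t / (2 * PI * (1 - r * axis_phase p t))
           - axis_rate p t / (2 * PI * (1 - axis_phase p t)))
    with (- ((1 - r) * (axis_rate p t / (2 * PI * ((1 - r * axis_phase p t) * (1 - axis_phase p t)))))) by (field; lra).
  set (w := 1 - r * axis_phase p t) in *. set (w1 := 1 - axis_phase p t) in *.
  assert (Hww : (mu * t) ^ 2 <= w * w1).
  { simpl. rewrite Rmult_1_r. apply Rmult_le_compat; lra. }
  assert (Hsq : 0 < (mu * t) ^ 2) by (apply pow_lt; lra).
  rewrite Rabs_Ropp, Rabs_mult, (Rabs_pos_eq (1 - r)) by lra.
  apply Rmult_le_compat_l; [lra|].
  rewrite Rabs_div by nra. rewrite (Rabs_pos_eq (2 * PI * (w * w1))) by nra.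
  apply Rmult_le_compat; [apply Rabs_pos|apply Rlt_le, Rinv_0_lt_compat; nra|exact HV|].
  apply Rinv_le_contravar; nra.
Qed.

(** Dominated convergence by hand.  Near 0 the difference of the integrands is bounded
    uniformly in r, since |D t| = O(t) and both kernels are O(1 / t); away from 0 the
    kernels converge uniformly, at rate 1 - r. *)
Lemma axis_kernel_limit (T : R) : 0 < T ->
  ctends_at_1 (fun r => CInt (fun t => RtoC (axis_kernel p r t) * D t)%C 0 T) (CInt axis_integrand 0 T).
Proof.
  intros HT eps He. pose proof PI_RGT_0 as Hpi.
  set (c1 := 2 * PI + 2 / p).
  assert (Hc1 : 0 < c1) by (unfold c1; assert (0 < 2 / p) by (apply Rdiv_lt_0_compat; lra); lra).
  destruct (HD0 1 Rlt_0_1) as [d0 [Hd0 HD1]].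
  set (cD := 1 + Cmod dD). pose proof (Cmod_ge_0 dD) as HdD.
  assert (HDlin : forall t, 0 <= t < d0 -> Cmod (D t) <= cD * t).
  { intros t Ht. specialize (HD1 t ltac:(rewrite Rabs_pos_eq; lra)).
    rewrite Rabs_pos_eq in HD1 by lra.
    replace (D t) with ((D t - RtoC t * dD) + RtoC t * dD)%C by ring.
    eapply Rle_trans; [apply Cmod_triangle|].
    rewrite Cmod_mult, Cmod_R, Rabs_pos_eq by lra. unfold cD. lra. }
  destruct (ccont_bounded D 0 T ltac:(lra) (fun x _ => HDc x)) as [M [HM0 HM]].
  (* On (0, T] the lower bound of [axis_den_ge] is at least mu t. *)
  set (mu := 2 * PI / (1 + 2 * PI * T)).
  assert (Hmu : 0 < mu) by (apply Rdiv_lt_0_compat; nra).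
  assert (Hmt : forall t, 0 < t <= T -> mu * t <= 2 * PI * t / (1 + 2 * PI * t)).
  { intros t Ht. unfold mu.
    replace (2 * PI / (1 + 2 * PI * T) * t) with (2 * PI * t / (1 + 2 * PI * T)) by (field; nra).
    apply Rmult_le_compat_l; [nra|]. apply Rinv_le_contravar; nra. }
  (* Bounds the difference of the integrands on [0, d]; the last summand is for t = 0. *)
  set (B := 2 * (cD * c1 / mu) + Cmod (axis_integrand 0)).
  assert (HB : 0 <= B).
  { unfold B. pose proof (Cmod_ge_0 (axis_integrand 0)).
    assert (0 < cD * c1 / mu) by (apply Rdiv_lt_0_compat; [unfold cD; nra|lra]). lra. }
  set (d := Rmin (Rmin (d0 / 2) T) (eps / (4 * (B + 1)))).
  assert (Hd : 0 < d).
  { unfold d. repeat apply Rmin_pos; try lra. apply Rdiv_lt_0_compat; lra. }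
  assert (Hdd : d < d0 /\ d <= T /\ d * B <= eps / 4).
  { unfold d. pose proof (Rmin_l (Rmin (d0 / 2) T) (eps / (4 * (B + 1)))) as H1.
    pose proof (Rmin_r (Rmin (d0 / 2) T) (eps / (4 * (B + 1)))) as H2.
    pose proof (Rmin_l (d0 / 2) T). pose proof (Rmin_r (d0 / 2) T).
    fold d in H1, H2 |- *.
    repeat split; try lra.
    apply Rmult_le_compat_r with (r := B + 1) in H2; [|lra].
    replace (eps / (4 * (B + 1)) * (B + 1)) with (eps / 4) in H2 by (field; lra). nra. }
  set (E := c1 / (mu * d) ^ 2 * M).
  assert (HE : 0 <= E).
  { unfold E. apply Rmult_le_pos; [|lra]. apply Rlt_le, Rdiv_lt_0_compat; [lra|]. apply pow_lt. nra. }
  assert (Hclose : at_left 1 (fun r => 1 - r < eps / (4 * (T * E + 1)))).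
  { assert (Hq : 0 < eps / (4 * (T * E + 1))) by (apply Rdiv_lt_0_compat; nra).
    exists (mkposreal _ Hq). intros r Hr _.
    unfold ball in Hr; simpl in Hr. unfold AbsRing_ball, abs, minus, plus, opp in Hr; simpl in Hr.
    apply Rabs_def2 in Hr. lra. }
  eapply at_left_imp; [|apply (at_left_and _ _ at_left_unit Hclose)].
  intros r [Hr Hr1].
  assert (Hkc : forall t, 0 <= t -> ccont (fun t => (RtoC (axis_kernel p r t) * D t)%C) t).
  { intros t Ht. apply ccont_scal; [|apply HDc]. apply axis_kernel_continuous; [exact Ht|].
    destruct (Req_dec t 0) as [->|]; [rewrite axis_phase_0; lra|apply axis_den_pos; lra]. }
  set (G := fun t => (RtoC (axis_kernel p r t) * D t - axis_integrand t)%C).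
  assert (HG : forall u v, 0 <= u -> u <= v -> ex_CInt G u v).
  { intros u v Hu Huv. apply ex_CInt_ccont; [exact Huv|]. intros t Ht.
    apply ccont_minus; [apply Hkc|apply axis_integrand_cont]; lra. }
  assert (EG : (CInt (fun t => RtoC (axis_kernel p r t) * D t)%C 0 T
    - CInt axis_integrand 0 T = CInt G 0 d + CInt G d T)%C).
  { rewrite CInt_Chasles by (apply HG; lra). symmetry. apply CInt_minus; apply ex_CInt_ccont; try lra;
      intros t Ht; [apply Hkc|apply axis_integrand_cont]; lra. }
  rewrite EG.
  assert (HG1 : Cmod (CInt G 0 d) <= (d - 0) * B).
  { apply CInt_norm_le_const; [lra|apply HG; lra|]. intros t Ht. unfold G.
    destruct (Req_dec t 0) as [->|n].
    - pose proof (HDlin 0 ltac:(lra)) as H0. rewrite Rmult_0_r in H0.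
      assert (D 0 = 0%C) as -> by (apply Cmod_eq_0, Rle_antisym; [exact H0|apply Cmod_ge_0]).
      replace (RtoC (axis_kernel p r 0) * 0 - axis_integrand 0%R)%C with (- axis_integrand 0%R)%C by ring. rewrite Cmod_opp.
      unfold B. assert (0 < cD * c1 / mu) by (apply Rdiv_lt_0_compat; [unfold cD; nra|lra]). lra.
    - rewrite axis_integrand_eq by lra.
      replace (RtoC (axis_kernel p r t) * D t - RtoC (axis_kernel p 1 t) * D t)%C
        with ((RtoC (axis_kernel p r t) + - RtoC (axis_kernel p 1 t)) * D t)%C by ring.
      rewrite Cmod_mult.
      assert (Hk : Cmod (RtoC (axis_kernel p r t) + - RtoC (axis_kernel p 1 t)) <= 2 * (c1 / (mu * t))).
      { eapply Rle_trans; [apply Cmod_triangle|]. rewrite Cmod_opp, !Cmod_R.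
        pose proof (axis_kernel_bound r t mu ltac:(lra) ltac:(lra) Hmu (Hmt t ltac:(lra))).
        pose proof (axis_kernel_bound 1 t mu ltac:(lra) ltac:(lra) Hmu (Hmt t ltac:(lra))).
        fold c1 in H, H0. lra. }
      apply Rle_trans with (2 * (c1 / (mu * t)) * (cD * t)).
      + apply Rmult_le_compat; try apply Cmod_ge_0; [exact Hk|apply HDlin; lra].
      + replace (2 * (c1 / (mu * t)) * (cD * t)) with (2 * (cD * c1 / mu)) by (field; lra).
        unfold B. pose proof (Cmod_ge_0 (axis_integrand 0)). lra. }
  assert (HG2 : Cmod (CInt G d T) <= (T - d) * ((1 - r) * E)).
  { apply CInt_norm_le_const; [lra|apply HG; lra|]. intros t Ht. unfold G.
    rewrite axis_integrand_eq by lra.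
    replace (RtoC (axis_kernel p r t) * D t - RtoC (axis_kernel p 1 t) * D t)%C
      with (RtoC (axis_kernel p r t - axis_kernel p 1 t) * D t)%C by (rewrite RtoC_minus; ring).
    rewrite Cmod_mult, Cmod_R. unfold E. rewrite <- Rmult_assoc.
    apply Rmult_le_compat; [apply Rabs_pos|apply Cmod_ge_0| |apply HM; lra].
    eapply Rle_trans; [apply (axis_kernel_diff_bound r t mu); try lra; apply Hmt; lra|].
    apply Rmult_le_compat_l; [lra|]. fold c1. apply Rmult_le_compat_l; [lra|].
    apply Rinv_le_contravar; [apply pow_lt; nra|]. apply pow_incr. split; nra. }
  eapply Rle_lt_trans; [apply Cmod_triangle|].
  assert (HQ : (1 - r) * (T * E + 1) < eps / 4).
  { apply Rmult_lt_compat_r with (r := T * E + 1) in Hr1; [|nra].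
    replace (eps / (4 * (T * E + 1)) * (T * E + 1)) with (eps / 4) in Hr1 by (field; nra). exact Hr1. }
  assert ((T - d) * ((1 - r) * E) <= (1 - r) * (T * E + 1)).
  { assert (0 <= (1 - r) * E) by nra. nra. }
  lra.
Qed.
End side.

(** * Improper integrals *)

Lemma R_ball_Rabs (x e y : R) : ball x e y -> Rabs (y - x) < e.
Proof. exact (fun H => H). Qed.

Lemma is_RInt_0_infty_elim (g : R -> R) (l : R) :
  is_RInt_0_infty g l -> forall eps, 0 < eps ->
  exists M, forall b, M < b -> Rabs (RInt g 0 b - l) < eps.
Proof.
  intros H eps He.
  destruct (H (ball l (mkposreal eps He)) (locally_ball l _)) as [Q S HQ [M HS] HP].
  exists M. intros b Hb. destruct (HP 0 b HQ (HS b Hb)) as [y [Hy1 Hy2]].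
  simpl in Hy1. rewrite (is_RInt_unique _ _ _ _ Hy1). exact Hy2.
Qed.

Lemma is_CInt_0_infty_intro (g : R -> C) (l : C) :
  (forall b, 0 < b -> ex_CInt g 0 b) ->
  (forall eps, 0 < eps -> exists M, forall b, M < b -> 0 < b -> Cmod (CInt g 0 b - l) < eps) ->
  is_CInt_0_infty g l.
Proof.
  intros Hex H P [eps HP]. destruct (H eps (cond_pos eps)) as [M HM].
  apply (Filter_prod _ _ _ (fun a => a = 0) (fun b => Rmax M 0 < b)).
  - reflexivity.
  - exists (Rmax M 0). auto.
  - intros a b -> Hb. pose proof (Rmax_l M 0). pose proof (Rmax_r M 0).
    exists (CInt g 0 b). split; [apply is_CInt, Hex; lra|].
    apply HP. specialize (HM b ltac:(lra) ltac:(lra)). split.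
    + eapply Rle_lt_trans; [|apply HM]. exact (Cmod_fst (CInt g 0 b - l)%C).
    + eapply Rle_lt_trans; [|apply HM]. exact (Cmod_snd (CInt g 0 b - l)%C).
Qed.

(** Comparison test, by the Cauchy criterion for the integrals over [0, b]. *)
Lemma absolutely_convergent (g : R -> C) (m : R -> R) (l : R) :
  (forall x, 0 <= x -> ccont g x) -> (forall x, 0 <= x -> continuous m x) ->
  (forall x, 0 <= x -> Cmod (g x) <= m x) -> is_RInt_0_infty m l ->
  exists L : C, forall eps, 0 < eps -> exists M, forall b, M < b -> Cmod (CInt g 0 b - L) < eps.
Proof.
  intros Hg Hm Hgm Hl.
  assert (Hexg : forall u v, 0 <= u -> u <= v -> ex_CInt g u v).
  { intros u v Hu Huv. apply ex_CInt_ccont; [exact Huv|]. intros; apply Hg; lra. }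
  assert (Hexm : forall u v, 0 <= u -> u <= v -> ex_RInt m u v).
  { intros u v Hu Huv. apply (ex_RInt_continuous (V := R_CompleteNormedModule)). intros x Hx.
    rewrite Rmin_left in Hx by lra. apply Hm. lra. }
  assert (Hc : forall eps, 0 < eps -> exists M, 0 <= M /\ forall u v, M < u -> u <= v ->
     Cmod (CInt g 0 v - CInt g 0 u) < eps).
  { intros eps He. destruct (is_RInt_0_infty_elim m l Hl (eps / 2) ltac:(lra)) as [M HM].
    exists (Rmax M 0). split; [apply Rmax_r|]. intros u v Hu Huv.
    pose proof (Rmax_l M 0). pose proof (Rmax_r M 0).
    rewrite <- (CInt_Chasles g 0 u v) by (apply Hexg; lra).
    replace (CInt g 0 u + CInt g u v - CInt g 0 u)%C with (CInt g u v) by ring.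
    eapply Rle_lt_trans.
    - apply (CInt_norm_le g m u v); [exact Huv|apply Hexg; lra|apply Hexm; lra|].
      intros; apply Hgm; lra.
    - assert (E : RInt m 0 u + RInt m u v = RInt m 0 v)
        by (apply (RInt_Chasles (V := R_CompleteNormedModule)); apply Hexm; lra).
      pose proof (HM u ltac:(lra)) as H1. pose proof (HM v ltac:(lra)) as H2.
      apply Rabs_def2 in H1. apply Rabs_def2 in H2. lra. }
  destruct (proj1 (filterlim_locally_cauchy (U := C_R_CompleteNormedModule)
    (F := Rbar_locally p_infty) (fun b => CInt g 0 b))) as [L HL].
  - intros eps. destruct (Hc eps (cond_pos eps)) as [M [HM0 HM]].
    exists (fun b => M < b). split; [exists M; auto|].
    intros u v Hu Hv.
    assert (Hb : Cmod (CInt g 0 v - CInt g 0 u) < eps).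
    { destruct (Rle_dec u v); [apply HM; lra|].
      replace (CInt g 0 v - CInt g 0 u)%C with (- (CInt g 0 u - CInt g 0 v))%C by ring.
      rewrite Cmod_opp. apply HM; lra. }
    split; (eapply Rle_lt_trans; [|apply Hb]).
    + exact (Cmod_fst (CInt g 0 v - CInt g 0 u)%C).
    + exact (Cmod_snd (CInt g 0 v - CInt g 0 u)%C).
  - exists L. intros eps He.
    assert (He2 : 0 < eps / 2) by lra.
    destruct (proj1 (filterlim_locally _ _) HL (mkposreal _ He2)) as [M HM].
    exists M. intros b Hb. specialize (HM b Hb). destruct HM as [H1 H2].
    apply R_ball_Rabs in H1. apply R_ball_Rabs in H2. simpl in H1, H2.
    eapply Rle_lt_trans; [apply Cmod_le_sum|].
    unfold Cminus, Cplus, Copp; cbn [fst snd]. unfold Rminus in H1, H2. simpl in *. lra.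
Qed.

Lemma RInt_le_line (g : R -> R) (l : R) :
  (forall y, continuous g y) -> (forall y, 0 <= g y) -> is_RInt_line g l ->
  forall c d, c <= d -> RInt g c d <= l.
Proof.
  intros Hg Hg0 H c d Hcd. apply le_epsilon. intros eps He.
  destruct (H (ball l (mkposreal eps He)) (locally_ball l _)) as [Q S [A HQ] [B HS] HP].
  set (a := Rmin (A - 1) c). set (b := Rmax (B + 1) d).
  assert (Ha : a < A /\ a <= c)
    by (unfold a; pose proof (Rmin_l (A - 1) c); pose proof (Rmin_r (A - 1) c); lra).
  assert (Hb : B < b /\ d <= b)
    by (unfold b; pose proof (Rmax_l (B + 1) d); pose proof (Rmax_r (B + 1) d); lra).
  destruct (HP a b (HQ a ltac:(lra)) (HS b ltac:(lra))) as [y [Hy1 Hy2]].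
  simpl in Hy1. apply R_ball_Rabs in Hy2. apply Rabs_def2 in Hy2. simpl in Hy2.
  rewrite <- (is_RInt_unique _ _ _ _ Hy1) in Hy2.
  assert (Hex : forall u v, ex_RInt g u v)
    by (intros; apply (ex_RInt_continuous (V := R_CompleteNormedModule)); auto).
  assert (E1 : RInt g a c + RInt g c b = RInt g a b)
    by (apply (RInt_Chasles (V := R_CompleteNormedModule)); apply Hex).
  assert (E2 : RInt g c d + RInt g d b = RInt g c b)
    by (apply (RInt_Chasles (V := R_CompleteNormedModule)); apply Hex).
  pose proof (RInt_ge_0 g a c ltac:(lra) (Hex _ _) ltac:(auto)).
  pose proof (RInt_ge_0 g d b ltac:(lra) (Hex _ _) ltac:(auto)). lra.
Qed.

(** * The kernels of the formula *)

Definition weight (p x : R) : R := (p * (p + 1 / PI) + x ^ 2) / (p ^ 2 + x ^ 2).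

Lemma dtheta_weight (p x : R) : 0 < p -> dtheta p x = 2 * PI * weight p x.
Proof.
  intros Hp. pose proof PI_RGT_0. unfold dtheta, weight. field. split; nra.
Qed.

Lemma weight_bound (p x : R) : 0 < p -> 0 <= weight p x <= 1 + 1 / (PI * p).
Proof.
  intros Hp. pose proof PI_RGT_0 as Hpi. unfold weight.
  assert (Hd : 0 < p ^ 2 + x ^ 2) by nra.
  assert (H1 : 0 < 1 / PI) by (apply Rdiv_lt_0_compat; lra).
  assert (H2 : 0 < 1 / (PI * p)) by (apply Rdiv_lt_0_compat; nra).
  split.
  - apply Rmult_le_pos; [|apply Rlt_le, Rinv_0_lt_compat, Hd]. nra.
  - apply Rmult_le_reg_r with (p ^ 2 + x ^ 2); [lra|].
    unfold Rdiv at 1. rewrite Rmult_assoc, Rinv_l, Rmult_1_r by lra.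
    assert (H3 : 1 / PI = 1 / (PI * p) * p) by (field; lra). rewrite H3. nra.
Qed.

Lemma weight_continuous (p x : R) : 0 < p -> continuous (weight p) x.
Proof.
  intros Hp. apply (ex_derive_continuous (weight p)). unfold weight. auto_derive. nra.
Qed.

(** Multiply numerator and denominator by e^{-2 pi t}. *)
Lemma koshliakov_kernel (p t : R) : 0 < p -> 0 < t ->
  (koshliakov_sigma p (- t) + Derive (koshliakov_sigma p) (- t) / (2 * PI))
    / (exp (2 * PI * t) - koshliakov_sigma p (- t)) = axis_kernel p 1 t.
Proof.
  intros Hp Ht. pose proof PI_RGT_0 as Hpi.
  assert (HD : Derive (koshliakov_sigma p) (- t) = 2 * p / (p + t) ^ 2).
  { apply is_derive_unique. unfold koshliakov_sigma. auto_derive; [lra|]. field. lra. }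
  pose proof (axis_den_pos p Hp 1 t ltac:(lra) Ht) as Hw.
  rewrite HD. unfold koshliakov_sigma, axis_kernel, axis_rate. unfold axis_phase in Hw |- *.
  rewrite Rmult_1_l in Hw. rewrite !Rmult_1_l.
  replace (- 2 * PI * t) with (- (2 * PI * t)) in * by ring. rewrite exp_Ropp in *.
  pose proof (exp_pos (2 * PI * t)) as He. set (e := exp (2 * PI * t)) in *.
  replace (p + - t) with (p - t) by ring. replace (p - - t) with (p + t) by ring.
  assert (Hq : e * (p + t) - (p - t) > 0).
  { apply Rmult_lt_compat_r with (r := e * (p + t)) in Hw; [|apply Rmult_lt_0_compat; lra].
    replace ((1 - / e * ((p - t) / (p + t))) * (e * (p + t))) with (e * (p + t) - (p - t)) in Hw
      by (field; lra). lra. }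
  field. repeat split; lra.
Qed.

(** * The summation formula on a finite range *)

Section main.
Variables (p : R) (lam : nat -> R) (f : C -> C).
Hypothesis Hp : 0 < p.
Hypothesis Hlam : forall n : nat, (1 <= n)%nat ->
  INR n - 1 / 2 < lam n < INR n /\ tan (PI * lam n) = - lam n / p.
Hypothesis Hf : forall x y, 0 <= x -> cdiff f (x, y).

Definition jump (t : R) : C := (f (0, t) - f (0, - t)%R)%C.

Lemma jump_cont (t : R) : ccont jump t.
Proof.
  assert (H : forall y, ccont (fun t => f (0, t)) y) by (intros y; apply cdiff_line_y, Hf; lra).
  apply ccont_minus; [apply H|].
  apply (continuous_comp (fun t => - t) (fun t => f (0, t))); [|apply H].
  apply (continuous_opp (V := R_NormedModule)). apply continuous_id.
Qed.

Lemma jump_derive_0 : exists dD : C, forall eps, 0 < eps -> exists del, 0 < del /\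
  forall t, Rabs t < del -> Cmod (jump t - RtoC t * dD) <= eps * Rabs t.
Proof.
  destruct (Hf 0 0 (Rle_refl 0)) as [l Hl]. exists (RtoC 2 * Ci * l)%C. intros eps He.
  destruct (is_cderive_eps f (0, 0) l Hl (eps / 2) ltac:(lra)) as [d [Hd H]].
  exists d. split; [exact Hd|]. intros t Ht.
  assert (E : forall s : R, ((0, s) - (0, 0) = Ci * RtoC s)%C)
    by (intros s; unfold Cminus, Cplus, Copp, Cmult, Ci, RtoC; simpl; f_equal; ring).
  assert (EM : forall s : R, Cmod (Ci * RtoC s) = Rabs s)
    by (intros s; rewrite Cmod_mult, Cmod_Ci, Cmod_R; ring).
  pose proof (H (0, t)) as H1. pose proof (H (0, - t)) as H2.
  rewrite E, EM in H1, H2. rewrite Rabs_Ropp in H2. specialize (H1 Ht). specialize (H2 Ht).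
  unfold jump.
  replace (f (0%R, t) - f (0%R, (- t)%R) - RtoC t * (RtoC 2 * Ci * l))%C
    with ((f (0%R, t) - f (0%R, 0%R) - Ci * RtoC t * l)
          + - (f (0%R, (- t)%R) - f (0%R, 0%R) - Ci * RtoC (- t) * l))%C
    by (rewrite RtoC_opp; ring).
  eapply Rle_trans; [apply Cmod_triangle|]. rewrite Cmod_opp. lra.
Qed.

(** [contour_estimate] in the limit r -> 1: its bound does not depend on r. *)
Lemma limit_estimate (H : R -> C) (T M1 M2 : R) (N : nat) :
  ctends_at_1 (fun r => CInt (fun t => RtoC (axis_kernel p r t) * jump t)%C 0 T) (CInt H 0 T) ->
  p <= INR (S N) -> 1 <= T ->
  (forall x, 0 <= x <= INR (S N) ->
     Cmod (f (x, T)) * exp (- 2 * PI * T) <= M1 /\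
     Cmod (f (x, - T)) * exp (- 2 * PI * T) <= M1) ->
  RInt (fun y => exp (- 2 * PI * y) * Cmod (f (INR (S N), y))) 0 T <= M2 ->
  RInt (fun y => exp (- 2 * PI * y) * Cmod (f (INR (S N), - y))) 0 T <= M2 ->
  Cmod (RtoC (2 * PI) * (RtoC (1 / 2) * f (0, 0)%R
          + sum_n (G := C_AbelianMonoid) (fun n => f (RtoC (lam (S n)))) N)
        + - RtoC (2 * PI) * CInt (fun x => RtoC (weight p x) * f (x, 0)%R)%C 0 (INR (S N))
        + - (RtoC (2 * PI) * Ci) * CInt H 0 T)
  <= 2 * kernel_const p * (INR (S N) * M1 + M2).
Proof.
  intros HH Hn HT HM1 HM2 HM3.
  assert (Hc : forall x, 0 <= x -> ccont (fun x => f (x, 0)) x)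
    by (intros x Hx; apply cdiff_line_x, Hf, Hx).
  assert (Hn0 : 0 <= INR (S N)) by lra.
  apply (ctends_norm_le (fun r =>
    CInt (fun x => RtoC (phase_poisson p r x) * f (x, 0%R)) 0 (INR (S N))
    + - RtoC (2 * PI) * CInt (fun x => RtoC (weight p x) * f (x, 0%R)) 0 (INR (S N))
    + - (RtoC (2 * PI) * Ci) * CInt (fun t => RtoC (axis_kernel p r t) * jump t) 0 T)%C).
  - intros r Hr.
    pose proof (contour_estimate p Hp f r T M1 M2 (S N) Hr Hn HT Hf HM1 HM2 HM3) as Hest.
    replace (CInt (fun x => RtoC (dtheta p x * (poisson r (theta p x) - 1)) * f (x, 0%R))%C 0 (INR (S N)))
      with (CInt (fun x => RtoC (phase_poisson p r x) * f (x, 0%R)) 0 (INR (S N))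
        + - RtoC (2 * PI) * CInt (fun x => RtoC (weight p x) * f (x, 0%R)) 0 (INR (S N)))%C in Hest.
    + match type of Hest with Cmod ?u <= _ => match goal with |- Cmod ?v <= _ =>
        replace v with u by (unfold jump; ring) end end. exact Hest.
    + assert (Ek : ex_CInt (fun x => RtoC (weight p x) * f (x, 0%R))%C 0 (INR (S N))).
      { apply ex_CInt_ccont; [lra|]. intros x Hx. apply ccont_scal; [apply weight_continuous, Hp|apply Hc; lra]. }
      rewrite <- CInt_scal, <- CInt_plus; [|  |apply ex_CInt_scal, Ek|exact Ek].
      * apply CInt_ext; [lra|]. intros x Hx. unfold phase_poisson.
        replace (dtheta p x * (poisson r (theta p x) - 1))
          with (dtheta p x * poisson r (theta p x) - 2 * PI * weight p x)
          by (rewrite dtheta_weight by exact Hp; ring).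
        rewrite RtoC_minus, (RtoC_mult (2 * PI) (weight p x)). ring.
      * apply ex_CInt_ccont; [lra|]. intros x Hx. apply ccont_scal; [apply phase_poisson_continuous; auto|apply Hc; lra].
  - apply ctends_plus; [apply ctends_plus; [|apply ctends_const]|].
    + exact (phase_poisson_limit p Hp (fun x => f (x, 0)) Hc lam Hlam N).
    + apply ctends_scal, HH.
Qed.
End main.

(** * The summation formula *)

(** The value of the second integral is prescribed by the formula; what has to be
    shown is that the integrals over [0, T] converge to it.  For a given tolerance,
    N is fixed first (series, first integral and right side are then under control),
    and only then T is taken large, since the bound on the top side depends on N. *)
Theorem theorem5p1 :
  forall (p : R) (lam : nat -> R) (f : C -> C),
    0 < p ->
    (forall n : nat, (1 <= n)%nat ->
       INR n - 1 / 2 < lam n < INR n /\ tan (PI * lam n) = - lam n / p) ->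
    (forall z : C, 0 <= Re z -> analytic_at f z) ->
    (exists I : R -> R,
       (forall y : R, is_RInt_0_infty (fun x : R => Cmod (f (x, y))) (I y)) /\
       (exists M Y : R, forall y : R, Y <= Rabs y -> I y <= M)) ->
    (forall a b : R, 0 <= a -> forall eps : R, 0 < eps ->
       Rbar_locally p_infty (fun y : R => forall x : R, a <= x <= b ->
         Cmod (f (x, y)) * exp (- 2 * PI * y) < eps /\
         Cmod (f (x, - y)) * exp (- 2 * PI * y) < eps)) ->
    (exists J : R -> R,
       Rbar_locally p_infty (fun r : R =>
         is_RInt_line
           (fun y : R => exp (- 2 * PI * Rabs y) * Cmod (f (r, y))) (J r)) /\
       is_lim J p_infty 0) ->
    @ex_series C_AbsRing C_NormedModule
      (fun n : nat => f (RtoC (lam (S n)))) ->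
    exists I1 I2 : C,
      is_CInt_0_infty
        (fun x : R =>
           (RtoC ((p * (p + 1 / PI) + x ^ 2) / (p ^ 2 + x ^ 2))
            * f (RtoC x))%C) I1 /\
      is_CInt_0_infty
        (fun t : R =>
           ((f (Ci * RtoC t) - f (- (Ci * RtoC t)))
            * RtoC ((koshliakov_sigma p (- t) + Derive (koshliakov_sigma p) (- t) / (2 * PI))
                    / (exp (2 * PI * t) - koshliakov_sigma p (- t))))%C) I2 /\
      @is_series C_AbsRing C_NormedModule
        (fun n : nat => f (RtoC (lam (S n))))
        (- (RtoC (1 / 2) * f (RtoC 0)) + I1 + Ci * I2)%C.
Proof.
  intros p lam f Hp Hlam Han [I [HI _]] Htop [J [HJ HJ0]] Hser.
  destruct (Hser : exists s : C, @is_series C_AbsRing C_NormedModule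
    (fun n : nat => f (RtoC (lam (S n)))) s) as [S0 HS].
  assert (Hf : forall x y, 0 <= x -> cdiff f (x, y)).
  { intros x y Hx. exact (locally_singleton (T := C_UniformSpace) (x, y) _ (Han (x, y) Hx)). }
  pose proof PI_RGT_0 as Hpi. pose proof (kernel_const_pos p Hp) as HC0.
  assert (Hreal : forall x, 0 <= x -> ccont (fun x => f (x, 0)) x)
    by (intros x Hx; apply cdiff_line_x, Hf, Hx).
  assert (Hkf : forall x, 0 <= x -> ccont (fun x => (RtoC (weight p x) * f (x, 0%R))%C) x).
  { intros x Hx. apply ccont_scal; [apply weight_continuous, Hp|apply Hreal, Hx]. }
  set (kmax := 1 + 1 / (PI * p)).
  destruct (absolutely_convergent (fun x => RtoC (weight p x) * f (x, 0%R))%C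
    (fun x => kmax * Cmod (f (x, 0))) (kmax * I 0)) as [I1 HI1].
  { exact Hkf. }
  { intros x Hx. apply (continuous_mult (K := R_AbsRing)); [apply continuous_const|].
    apply (ccont_Cmod (fun x => f (x, 0))), Hreal, Hx. }
  { intros x Hx. rewrite Cmod_mult, Cmod_R. pose proof (weight_bound p x Hp) as [Hk1 Hk2].
    rewrite Rabs_pos_eq by exact Hk1. apply Rmult_le_compat_r; [apply Cmod_ge_0|exact Hk2]. }
  { apply (is_RInt_gen_scal (V := R_NormedModule) (fun x => Cmod (f (x, 0))) kmax (I 0)). apply HI. }
  destruct (jump_derive_0 f Hf) as [dD HdD].
  set (H := axis_integrand p (jump f) dD).
  assert (HHc : forall t, 0 <= t -> ccont H t)
    by (intros t Ht; apply axis_integrand_cont; auto; apply jump_cont, Hf).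
  set (I2 := (- Ci * (S0 + RtoC (1 / 2) * f (0%R, 0%R) - I1))%C).
  assert (HI2 : (Ci * I2 = S0 + RtoC (1 / 2) * f (0%R, 0%R) - I1)%C).
  { unfold I2. assert (E : (Ci * - Ci = 1)%C)
      by (unfold Ci, Cmult, Copp, RtoC; simpl; f_equal; ring).
    rewrite Cmult_assoc, E. ring. }
  exists I1, I2. split; [|split].
  - apply is_CInt_0_infty_intro.
    + intros b Hb. apply ex_CInt_ccont; [lra|]. intros x Hx. exact (Hkf x (proj1 Hx)).
    + intros eps He. destruct (HI1 eps He) as [M HM]. exists M. intros b Hb _. exact (HM b Hb).
  - assert (Heq : forall t, 0 < t -> H t =
      ((f (Ci * RtoC t) - f (- (Ci * RtoC t)))
            * RtoC ((koshliakov_sigma p (- t) + Derive (koshliakov_sigma p) (- t) / (2 * PI))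
                    / (exp (2 * PI * t) - koshliakov_sigma p (- t))))%C).
    { intros t Ht. unfold H. rewrite axis_integrand_eq, koshliakov_kernel by auto. unfold jump.
      replace (Ci * RtoC t)%C with ((0, t) : C)
        by (unfold Ci, RtoC, Cmult; simpl; f_equal; ring).
      replace (- (0%R, t))%C with ((0, - t) : C)
        by (unfold Copp; simpl; f_equal; ring).
      ring. }
    apply is_CInt_0_infty_intro.
    + intros b Hb.
      assert (Hex : ex_CInt H 0 b)
        by (apply ex_CInt_ccont; [lra|]; intros x Hx; apply HHc; lra).
      destruct Hex as [l Hl]. exists l. eapply is_RInt_ext; [|exact Hl].
      rewrite Rmin_left, Rmax_right by lra. intros x Hx. apply Heq. lra.
    + intros eps He. set (e := eps / 4). assert (Hepos : 0 < e) by (unfold e; lra).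
      (* Chosen so that the error 2 C (e' + e') of the contour equals 2 pi e. *)
      set (e' := e * PI / (2 * kernel_const p)).
      assert (He' : 0 < e') by (unfold e'; apply Rdiv_lt_0_compat; nra).
      destruct (proj1 (filterlim_locally _ _) HS (mkposreal (e / 2) ltac:(lra))) as [N1 HN1].
      destruct (HI1 e Hepos) as [B2 HB2].
      destruct HJ as [B3 HB3].
      destruct (proj2 (is_lim_spec _ _ _) HJ0 (mkposreal e' He')) as [B4 HB4].
      destruct (INR_unbounded (Rmax (Rmax p B2) (Rmax B3 B4))) as [N2 HN2].
      set (N := Nat.max N1 N2).
      assert (HN : Rmax (Rmax p B2) (Rmax B3 B4) < INR (S N)).
      { eapply Rlt_le_trans; [apply HN2|]. apply le_INR. unfold N. lia. }
      assert (HNs : p < INR (S N) /\ B2 < INR (S N) /\ B3 < INR (S N) /\ B4 < INR (S N)).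
      { pose proof (Rmax_l (Rmax p B2) (Rmax B3 B4)). pose proof (Rmax_r (Rmax p B2) (Rmax B3 B4)).
        pose proof (Rmax_l p B2). pose proof (Rmax_r p B2).
        pose proof (Rmax_l B3 B4). pose proof (Rmax_r B3 B4). lra. }
      destruct HNs as (HNp & HN2' & HN3 & HN4).
      set (sN := sum_n (G := C_AbelianMonoid) (fun n => f (RtoC (lam (S n)))) N).
      assert (HsN : Cmod (sN - S0) < e).
      { specialize (HN1 N ltac:(unfold N; lia)).
        apply C_NormedModule_mixin_compat2 in HN1. simpl in HN1.
        assert (Hs2 : sqrt 2 <= 2).
        { rewrite <- (sqrt_square 2) at 2 by lra. apply sqrt_le_1_alt. lra. }
        change (Cmod (sN - S0) < sqrt 2 * (e / 2)) in HN1. nra. }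
      specialize (HB2 _ HN2'). specialize (HB3 _ HN3). specialize (HB4 _ HN4).
      change (Rabs (J (INR (S N)) - 0) < e') in HB4. rewrite Rminus_0_r in HB4. apply Rabs_def2 in HB4.
      set (n := INR (S N)) in *.
      assert (Hline : forall c d, c <= d ->
        RInt (fun y => exp (- 2 * PI * Rabs y) * Cmod (f (n, y))) c d <= J n).
      { apply RInt_le_line; [| |exact HB3].
        - intros y. apply (continuous_mult (K := R_AbsRing)).
          + apply (continuous_comp Rabs (fun s => exp (- 2 * PI * s))); [apply continuous_Rabs|].
            apply continuous_exp_lin.
          + apply (ccont_Cmod (fun y => f (n, y))), cdiff_line_y, Hf. lra.
        - intros y. apply Rmult_le_pos; [apply Rlt_le, exp_pos|apply Cmod_ge_0]. }
      destruct (Htop 0 n (Rle_refl 0) (e' / n) ltac:(apply Rdiv_lt_0_compat; lra)) as [T0 HT0].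
      exists (Rmax T0 1). intros T HT HTpos.
      assert (HT1 : T0 < T /\ 1 < T) by (pose proof (Rmax_l T0 1); pose proof (Rmax_r T0 1); lra).
      pose proof (limit_estimate p lam f Hp Hlam Hf H T (e' / n) (J n) N) as Hest.
      fold n sN in Hest.
      specialize (Hest (axis_kernel_limit p Hp (jump f) (jump_cont f Hf) dD HdD T HTpos)).
      specialize (Hest ltac:(lra) ltac:(lra)).
      specialize (Hest ltac:(intros x Hx; destruct (HT0 T (proj1 HT1) x Hx); split; lra)).
      assert (HR1 : RInt (fun y => exp (- 2 * PI * y) * Cmod (f (n, y))) 0 T <= J n).
      { eapply Rle_trans; [|apply (Hline 0 T); lra]. right. apply RInt_ext.
        rewrite Rmin_left by lra. intros y Hy. rewrite Rabs_pos_eq by lra. reflexivity. }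
      assert (HR2 : RInt (fun y => exp (- 2 * PI * y) * Cmod (f (n, - y))) 0 T <= J n).
      { eapply Rle_trans; [|apply (Hline (- T) 0); lra]. right.
        set (G := fun y => exp (- 2 * PI * Rabs y) * Cmod (f (n, y))).
        assert (HG : ex_RInt G 0 (- T)).
        { apply (ex_RInt_continuous (V := R_CompleteNormedModule)). intros y _.
          apply (continuous_mult (K := R_AbsRing)).
          + apply (continuous_comp Rabs (fun s => exp (- 2 * PI * s))); [apply continuous_Rabs|].
            apply continuous_exp_lin.
          + apply (ccont_Cmod (fun y => f (n, y))), cdiff_line_y, Hf. lra. }
        pose proof (RInt_correct (V := R_CompleteNormedModule) G 0 (- T) HG) as HG1.
        rewrite <- (Ropp_0) in HG1 at 1.
        apply (is_RInt_comp_opp (V := R_NormedModule)) in HG1.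
        apply (is_RInt_opp (V := R_NormedModule)) in HG1.
        fold G. rewrite <- (opp_RInt_swap (V := R_CompleteNormedModule) G 0 (- T) HG).
        apply is_RInt_unique.
        eapply is_RInt_ext; [|exact HG1]. rewrite Rmin_left by lra. intros y Hy.
        unfold opp, G; simpl. rewrite Ropp_involutive, Rabs_Ropp, Rabs_pos_eq by lra. reflexivity. }
      specialize (Hest HR1 HR2).
      assert (EH : CInt (fun t => (f (Ci * RtoC t) - f (- (Ci * RtoC t)))
            * RtoC ((koshliakov_sigma p (- t) + Derive (koshliakov_sigma p) (- t) / (2 * PI))
                    / (exp (2 * PI * t) - koshliakov_sigma p (- t))))%C 0 T = CInt H 0 T).
      { apply CInt_ext; [lra|]. intros t Ht. symmetry. apply Heq. lra. }
      rewrite EH. clear EH.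
      set (L := CInt H 0 T) in *.
      set (AN := CInt (fun x => RtoC (weight p x) * f (x, 0%R))%C 0 n) in *.
      assert (E2pi : Cmod (RtoC (2 * PI)) = 2 * PI) by (rewrite Cmod_R; apply Rabs_pos_eq; lra).
      assert (Hfin : 2 * PI * Cmod (L - I2)
        <= 2 * kernel_const p * (n * (e' / n) + J n) + 2 * PI * e + 2 * PI * e).
      { replace (2 * PI * Cmod (L - I2)) with (Cmod (RtoC (2 * PI) * Ci * (L - I2)))
          by (rewrite !Cmod_mult, Cmod_Ci, E2pi; ring).
        replace (RtoC (2 * PI) * Ci * (L - I2))%C with
          (- (RtoC (2 * PI) * (RtoC (1 / 2) * f (0, 0)%R + sN)
              + - RtoC (2 * PI) * AN + - (RtoC (2 * PI) * Ci) * L)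
           + RtoC (2 * PI) * (sN - S0) + RtoC (2 * PI) * - (AN - I1))%C.
        2: { replace (RtoC (2 * PI) * Ci * (L - I2))%C
               with (RtoC (2 * PI) * Ci * L - RtoC (2 * PI) * (Ci * I2))%C by ring.
             rewrite HI2. ring. }
        eapply Rle_trans; [apply Cmod_triangle|].
        eapply Rle_trans; [apply Rplus_le_compat_r, Cmod_triangle|].
        rewrite Cmod_opp, !(Cmod_mult (RtoC (2 * PI)) (_ - _)%C), (Cmod_mult _ (- _)%C), Cmod_opp, E2pi.
        apply Rplus_le_compat; [apply Rplus_le_compat|]; [exact Hest| |];
          apply Rmult_le_compat_l; lra. }
      replace (n * (e' / n)) with e' in Hfin by (field; lra).
      assert (Hce : 2 * kernel_const p * (e' + J n) <= 2 * PI * e).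
      { replace (2 * PI * e) with (2 * kernel_const p * (e' + e')) by (unfold e'; field; lra).
        apply Rmult_le_compat_l; lra. }
      apply Rmult_lt_reg_l with (2 * PI); [lra|].
      apply Rle_lt_trans with (2 * PI * (3 * e)); [lra|].
      apply Rmult_lt_compat_l; [lra|]. unfold e. lra.
  - replace (- (RtoC (1 / 2) * f (RtoC 0)) + I1 + Ci * I2)%C with S0; [exact HS|].
    rewrite HI2. change (RtoC 0) with ((0, 0) : C). ring.
Qed.
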